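(* Let $q=e^{2\pi i\tau}$, $\tau$ real and irrational. Assume that $r<R(q)$ and that $H_q$ has poles of total multiplicity $\ell$ on $\{z:|z|=r\}$. Let $U$ be an open set containing this circle. Then there exists $n_0$ such that for $n\ge n_0$, $\mu_n/\nu_n$ has poles of total multiplicity $\ge2\ell$ in $U$.
   Context: For $|q|=1$, $q$ not a root of unity, $G_q(z):=\sum_{j=0}^\infty\frac{q^{j^2}}{(1-q)(1-q^2)\cdots(1-q^j)}z^j$, with radius of convergence $R(q)$, and $H_q(z):=G_q(z)/G_q(qz)$, a meromorphic function in $\{|z|<R(q)\}$ (analytic at $0$). For $n\ge0$, $\mu_n,\nu_n$ are the numerator and denominator polynomials of the $n$th convergent of the continued fraction $1+\cfrac{qz}{1+\cfrac{q^2z}{1+\cdots}}$: $\mu_0=\nu_0=1$, $\mu_1(z)=1+qz$, $\nu_1(z)=1$, and for $n\ge2$, $\mu_n(z)=\mu_{n-1}(z)+q^nz\,\mu_{n-2}(z)$, $\nu_n(z)=\nu_{n-1}(z)+q^nz\,\nu_{n-2}(z)$. *)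

(* Defs.v *)
From HB Require Import structures.
From mathcomp Require Import all_boot all_order all_algebra.
From mathcomp Require Import all_classical all_reals all_analysis.
From mathcomp Require Import complex.

Set Implicit Arguments.
Unset Strict Implicit.
Unset Printing Implicit Defensive.

Import Order.TTheory GRing.Theory Num.Theory numFieldNormedType.Exports.

Local Open Scope classical_set_scope.
Local Open Scope ring_scope.
Local Open Scope complex_scope.

(* [R[i]] has no canonical topology; naming it as a [numClosedFieldType] gives
   it the one induced by its norm, which is [R[i]]-valued: [`|z| = r%:C] says
   that [z] has modulus [r : R]. *)
Definition CC (R : realType) : numClosedFieldType := R[i].

Section PowerSeries.
Context {R : realType}.
Implicit Types (a : nat -> CC R) (z : CC R).

Definition cpseries a z : nat -> CC R := series (fun j => a j * z ^+ j).

Definition convergence_radius a : \bar R :=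
  ereal_sup [set (complex.Re `|z|)%:E | z in [set z | cvgn (cpseries a z)]].

End PowerSeries.

Section Poles.
Context {R : realType}.
Implicit Types (f : CC R -> CC R) (a : CC R) (A : set (CC R)).

Definition holomorphic_at f a := \forall z \near a, derivable f z 1.

(* The value of [f] at [a] itself is irrelevant, so that the convention
   [x / 0 = 0] does no harm when [f] is a quotient. *)
Definition pole_of_order f a (m : nat) :=
  (0 < m)%N /\
  exists g : CC R -> CC R,
    [/\ holomorphic_at g a, g a != 0
      & \forall z \near a^', f z = g z / (z - a) ^+ m].

(* [f] has finitely many poles in [A], enumerated without repetition by [s],
   and their orders add up to [N]. *)
Definition total_pole_multiplicity f A (N : nat) :=
  exists (s : seq (CC R)) (m : CC R -> nat),
    [/\ uniq s,
        forall a, a \in s -> A a /\ pole_of_order f a (m a),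
        forall a k, A a -> pole_of_order f a k -> a \in s
      & N = (\sum_(a <- s) m a)%N].

End Poles.

Section RogersRamanujan.
Context {R : realType}.

(* e^{2 pi i tau}, by Euler's formula *)
Definition expi2pi (tau : R) : CC R :=
  cos (2 * pi * tau) +i* sin (2 * pi * tau).

Variable q : CC R.

Definition G_coef (j : nat) : CC R :=
  q ^+ (j ^ 2) / \prod_(1 <= k < j.+1) (1 - q ^+ k).

Definition G (z : CC R) : CC R := limn (cpseries G_coef z).

Definition G_radius : \bar R := convergence_radius G_coef.

Definition H (z : CC R) : CC R := G z / G (q * z).

Fixpoint mu (n : nat) : {poly CC R} :=
  if n is n1.+1 then
    if n1 is n2.+1 then mu n1 + q ^+ n *: 'X * mu n2 else 1 + q *: 'X
  else 1.

Fixpoint nu (n : nat) : {poly CC R} :=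
  if n is n1.+1 then
    if n1 is n2.+1 then nu n1 + q ^+ n *: 'X * nu n2 else 1
  else 1.

Definition convergent (n : nat) (z : CC R) : CC R := (mu n).[z] / (nu n).[z].

End RogersRamanujan.

Definition circle {R : realType} (r : R) : set (CC R) :=
  [set z | `|z| = r%:C].

(* Main.v *)
Require Import Defs.
From HB Require Import structures.
From mathcomp Require Import all_boot all_order all_algebra.
From mathcomp Require Import all_classical all_reals all_analysis.
From mathcomp Require Import complex zify ring lra.

Set Implicit Arguments.
Unset Strict Implicit.
Unset Printing Implicit Defensive.

Import Order.TTheory GRing.Theory Num.Theory numFieldNormedType.Exports.

Local Open Scope classical_set_scope.
Local Open Scope ring_scope.

(** Let [Gconj z = (G z^* )^*], which is the function [G] for [q^-1] in place of
    [q].  From [G z = G (q z) + q z G (q^2 z)] and its conjugate, both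
    [Gconj (q^(n+1) z)] and [(- z)^(n+1) q^(1+...+(n+1)) G (q^(n+2) z)] satisfy the
    three-term recurrence of [nu n], so that, on any disc where the series [G]
    converges,

      [nu n (z) = G (q z) Gconj (q^(n+1) z)
                  - (- z)^(n+1) q^(1+...+(n+1)) Gconj z G (q^(n+2) z)]

    ([nu_shift_formula]); the constants come from the Casoratian identity
    [G (q z) Gconj (q z) + q z Gconj z G (q^2 z) = 1] ([G_casoratian]).  The
    radius of convergence is at most [1] ([radius_le1]), whence [r < 1] and the
    second term is negligible near the circle: [nu n] is close to
    [G (q z) Gconj (q^(n+1) z)].  By the Casoratian identity again, the poles of
    [H] are exactly as singular as the zeros of [G (q z)] ([H_pole_order]).  So
    [G (q z)] has [l] zeros on the circle, and [Gconj (q^(n+1) z)] has the images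
    of these under [a |-> (q a)^* / q^(n+1)], on the same circle: this is where
    the factor [2] comes from.  The images move with [n], but as the
    powers of [q] stay on the unit circle, it suffices by compactness to treat the
    [n] for which [q^(n+1)] is near a given [b] ([rotation_compact]); there
    a Hurwitz theorem at the zeros of [G (q z) Gconj (b z)] applies
    ([hurwitz_local], [doubled_zeros]).  Finally [mu n] and [nu n] have no common
    zero, so that the poles of the convergent are the zeros of [nu n]
    ([convergent_poles]).

    The complex analysis needed is derived from one averaging principle: for
    [|q| = 1] and [q] not a root of unity, the averages of [p (q^j z) / q^(j k)]
    over [j < N] tend to the term of degree [k] of the polynomial [p] at [z]
    ([avg_poly]).  It yields the mean value property for uniform limits of
    polynomials, the constancy of those invariant under [z |-> q z], the bound on
    the radius, and the finiteness of orders of zeros ([finite_order]).  The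
    Hurwitz theorem concerns polynomials near the limit, so that only a minimum
    principle for polynomials ([min_principle]) is needed. *)

(** * Real-valued modulus and epsilon-delta forms of the complex topology *)

(** The norm of [CC R] is [CC R]-valued; estimates are carried out in [R],
    where the order is total. *)
Definition cmod {R : realType} (z : CC R) : R := complex.Re `|z|.

Section Modulus.
Variable R : realType.
Implicit Types (x y z : CC R) (u : nat -> CC R).

Lemma cmodE z : `|z| = (cmod z)%:C%C.
Proof. by rewrite /cmod normc_def. Qed.

Lemma cmodM x y : cmod (x * y) = cmod x * cmod y.
Proof. by apply: complexI; rewrite rmorphM /= -!cmodE normrM. Qed.

Lemma cmodD x y : cmod (x + y) <= cmod x + cmod y.
Proof. by rewrite -lecR rmorphD /= -!cmodE ler_normD. Qed.

Lemma cmodN x : cmod (- x) = cmod x.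
Proof. by rewrite /cmod normrN. Qed.

Lemma cmodBC x y : cmod (x - y) = cmod (y - x).
Proof. by rewrite -cmodN opprB. Qed.

Lemma cmod_ge0 x : 0 <= cmod x.
Proof. by rewrite -lecR -cmodE normr_ge0. Qed.

Lemma cmod0 : cmod 0 = 0 :> R.
Proof. by rewrite /cmod normr0. Qed.

Lemma cmod1 : cmod 1 = 1 :> R.
Proof. by rewrite /cmod normr1. Qed.

Lemma cmod_eq0 x : (cmod x == 0) = (x == 0).
Proof. by rewrite -(inj_eq (@complexI R)) -cmodE normr_eq0. Qed.

Lemma cmod_gt0 x : (0 < cmod x) = (x != 0).
Proof. by rewrite lt_neqAle cmod_ge0 andbT eq_sym cmod_eq0. Qed.

Lemma cmodX x n : cmod (x ^+ n) = cmod x ^+ n.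
Proof.
by elim: n => [|n IH]; rewrite ?expr0 ?cmod1 // !exprS cmodM IH.
Qed.

Lemma cmodV x : cmod x^-1 = (cmod x)^-1.
Proof.
have [->|x0] := eqVneq x 0; first by rewrite invr0 cmod0 invr0.
apply: (mulfI (x := cmod x)); first by rewrite cmod_eq0.
by rewrite -cmodM !divff ?cmod1 // cmod_eq0.
Qed.

Lemma cmod_real (r : R) : cmod (r%:C%C : CC R) = `|r|.
Proof. by rewrite /cmod normc_def /= expr0n /= addr0 sqrtr_sqr. Qed.

Lemma cmod_pos (r : R) : 0 <= r -> cmod (r%:C%C : CC R) = r.
Proof. by move=> r0; rewrite cmod_real ger0_norm. Qed.

Lemma cmod_nat n : cmod (n%:R : CC R) = n%:R.
Proof. by rewrite -(rmorph_nat (real_complex R)) cmod_real ger0_norm. Qed.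

Lemma cmod_conj z : cmod (z^*)%C = cmod z.
Proof. by rewrite /cmod !normc_def; case: z => a b /=; rewrite sqrrN. Qed.

Lemma conjB x y : ((x - y)^*)%C = (x^*)%C - (y^*)%C.
Proof. exact: (raddfB (@conjc R)). Qed.

Lemma conjM x y : ((x * y)^*)%C = (x^*)%C * (y^*)%C.
Proof. exact: (rmorphM (@conjc R)). Qed.

Lemma mulC_conj z : z * (z^*)%C = (cmod z ^+ 2)%:C%C.
Proof.
rewrite rmorphXn /= -cmodE -add_Re2_Im2; case: z => a b /=.
by apply/eqP; rewrite eq_complex /= -!expr2; apply/andP; split; apply/eqP; ring.
Qed.

Lemma cmod_sum (I : Type) (r : seq I) (P : pred I) (F : I -> CC R) :
  cmod (\sum_(i <- r | P i) F i) <= \sum_(i <- r | P i) cmod (F i).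
Proof.
elim/big_ind2: _ => //; first by rewrite cmod0.
move=> x1 x2 y1 y2 h1 h2; have := cmodD x2 y2; lra.
Qed.

Lemma cmod_prod (I : Type) (r : seq I) (P : pred I) (F : I -> CC R) :
  cmod (\prod_(i <- r | P i) F i) = \prod_(i <- r | P i) cmod (F i).
Proof. exact: (big_morph _ cmodM cmod1). Qed.

Lemma cmodB_le x y z : cmod (x - z) <= cmod (x - y) + cmod (y - z).
Proof. by rewrite -[x - z](subrKA y) cmodD. Qed.

Lemma cmod_lower x y : cmod x - cmod (x - y) <= cmod y.
Proof. by have := cmodD (x - y) y; rewrite subrK; lra. Qed.

Lemma Re_le_cmod z : `|complex.Re z| <= cmod z.
Proof.
rewrite /cmod normc_def /= -sqrtr_sqr ler_wsqrtr // lerDl sqr_ge0 //.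
Qed.

Lemma Im_le_cmod z : `|complex.Im z| <= cmod z.
Proof.
by rewrite /cmod normc_def /= -sqrtr_sqr ler_wsqrtr // lerDr sqr_ge0.
Qed.

Lemma cmod_le_ReIm z : cmod z <= `|complex.Re z| + `|complex.Im z|.
Proof.
rewrite {1}[z]complexE; apply: le_trans (cmodD _ _) _.
rewrite cmodM !cmod_real.
have -> : cmod ('i%C : CC R) = 1.
  by rewrite /cmod normc_def /= expr0n /= add0r expr1n sqrtr1.
by rewrite mul1r.
Qed.

Definition cvgC u z := forall e : R, 0 < e ->
  exists N, forall n, (N <= n)%N -> cmod (u n - z) <= e.

Lemma near_cmodP (a : CC R) (P : set (CC R)) :
  (\forall z \near a, P z) <->
  exists2 d : R, 0 < d & forall z, cmod (z - a) < d -> P z.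
Proof.
split.
- move=> /nbhs_ballP[e /= e0 he].
  have [d ed] : exists d : R, e = d%:C%C.
    by apply/complex_realP; apply: gtr0_real.
  exists d; first by rewrite -ltcR -ed.
  move=> z hz; apply: he; rewrite /ball /= ed distrC.
  by have := hz; rewrite -ltcR -cmodE.
- case=> d d0 hd; apply/nbhs_ballP; exists (d%:C%C); first by rewrite /= ltcR.
  move=> z; rewrite /ball /= distrC cmodE ltcR; exact: hd.
Qed.

Lemma dnbhs_cmodP (a : CC R) (P : set (CC R)) :
  (\forall z \near a^', P z) <->
  exists2 d : R, 0 < d & forall z, cmod (z - a) < d -> z != a -> P z.
Proof.
split.
- move=> h; have /near_cmodP[d d0 hd] : \forall z \near a, z != a -> P z.
    by have := h; rewrite near_withinE.
  by exists d.
- case=> d d0 hd; rewrite near_withinE; apply/near_cmodP; exists d => //.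
Qed.

Lemma cvgC_cvgn u z : cvgC u z <-> u @ \oo --> z.
Proof.
split.
- move=> h; apply/cvgrPdist_le => e e0.
  have [d ed] : exists d : R, e = d%:C%C.
    by apply/complex_realP; apply: gtr0_real.
  have [|N hN] := h d; first by rewrite -ltcR -ed.
  exists N => // n /= hn; rewrite ed distrC cmodE lecR; exact: hN.
- move=> /cvgrPdist_le h e e0.
  have [|N _ hN] := h (e%:C%C); first by rewrite ltcR.
  exists N => n hn; rewrite -lecR -cmodE distrC; exact: hN.
Qed.

Lemma cvgC_lim u z : cvgC u z -> limn u = z.
Proof. by move=> /cvgC_cvgn; apply: cvg_lim; exact: norm_hausdorff. Qed.

Lemma real_cauchy (v : nat -> R) :
  (forall e : R, 0 < e -> exists N, forall m n, (N <= m)%N -> (N <= n)%N ->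
     `|v m - v n| <= e) ->
  exists l, forall e : R, 0 < e ->
     exists N, forall n, (N <= n)%N -> `|v n - l| <= e.
Proof.
move=> hv.
have cv : cvgn v.
  apply/cauchy_cvgP; apply/cauchy_ballP => e e0.
  have [|N hN] := hv (e / 2); first by rewrite divr_gt0.
  exists (v @` [set n | N <= n]%N, v @` [set n | N <= n]%N).
    by split; exists N => // n /= hn; exists n.
  move=> [x y] [/= [m hm <-] [n hn <-]]; rewrite /ball /=.
  apply: le_lt_trans (hN _ _ hm hn) _; lra.
exists (limn v) => e e0.
have /cvgrPdist_le /(_ e e0)[N _ hN] := cv.
by exists N => n hn; rewrite distrC; exact: hN.
Qed.

Lemma cvgC_cauchy u :
  (forall e : R, 0 < e -> exists N, forall m n, (N <= m)%N -> (N <= n)%N ->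
     cmod (u m - u n) <= e) ->
  exists z, cvgC u z.
Proof.
move=> hu.
have [e e0|a ha] := @real_cauchy (fun n => complex.Re (u n)).
  have [N hN] := hu e e0; exists N => m n hm hn.
  rewrite -raddfB; exact: le_trans (Re_le_cmod _) (hN _ _ hm hn).
have [e e0|b hb] := @real_cauchy (fun n => complex.Im (u n)).
  have [N hN] := hu e e0; exists N => m n hm hn.
  rewrite -raddfB; exact: le_trans (Im_le_cmod _) (hN _ _ hm hn).
exists (a +i* b)%C => e e0.
have e2 : 0 < e / 2 by lra.
have [N1 h1] := ha _ e2; have [N2 h2] := hb _ e2.
exists (maxn N1 N2) => n; rewrite geq_max => /andP[/h1 {}h1 /h2 {}h2].
apply: le_trans (cmod_le_ReIm _) _.
by move: h1 h2; case: (u n) => c d /=; lra.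
Qed.

Lemma cvgC_le u z w (c : R) :
  cvgC u z -> (exists N, forall n, (N <= n)%N -> cmod (u n - w) <= c) ->
  cmod (z - w) <= c.
Proof.
move=> h [N hN]; apply/ler_addgt0Pr => e e0.
have [N' hN'] := h e e0.
have := hN _ (leq_maxl N N'); have := hN' _ (leq_maxr N N').
by have := cmodB_le z (u (maxn N N')) w; rewrite [cmod (z - u _)]cmodBC; lra.
Qed.

Lemma cvgC_uniq u z w : cvgC u z -> cvgC u w -> z = w.
Proof.
move=> hz hw; apply/eqP; rewrite -subr_eq0 -cmod_eq0 eq_le cmod_ge0 andbT.
by apply/ler_addgt0Pr => e e0; rewrite add0r; apply: cvgC_le hz (hw _ e0).
Qed.

Lemma cvgCD u (v : nat -> CC R) z w :
  cvgC u z -> cvgC v w -> cvgC (fun n => u n + v n) (z + w).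
Proof.
move=> hu hv e e0; have e2 : 0 < e / 2 by lra.
have [N1 h1] := hu _ e2; have [N2 h2] := hv _ e2.
exists (maxn N1 N2) => n; rewrite geq_max => /andP[/h1 {}h1 /h2 {}h2].
by rewrite opprD addrACA; have := cmodD (u n - z) (v n - w); lra.
Qed.

Lemma cvgCZ u c z : cvgC u z -> cvgC (fun n => c * u n) (c * z).
Proof.
move=> hu e e0; have c1 : 0 < cmod c + 1 by have := cmod_ge0 c; lra.
have [N hN] := hu _ (divr_gt0 e0 c1); exists N => n /hN {}hN.
rewrite -mulrBr cmodM; apply: le_trans (_ : (cmod c + 1) * cmod (u n - z) <= _).
  by rewrite ler_wpM2r ?cmod_ge0 //; lra.
by rewrite mulrC -ler_pdivlMr.
Qed.

Lemma cvgCB u (v : nat -> CC R) z w :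
  cvgC u z -> cvgC v w -> cvgC (fun n => u n - v n) (z - w).
Proof.
move=> hu /(cvgCZ (-1)) hv; have := cvgCD hu hv; rewrite mulN1r.
by under eq_fun do rewrite mulN1r.
Qed.

Lemma cvgC_cst z : cvgC (fun=> z) z.
Proof. by move=> e e0; exists 0%N => n _; rewrite subrr cmod0 ltW. Qed.

End Modulus.

(** * Averages over an irrational rotation *)

Section Averages.
Variable R : realType.
Implicit Types (z w : CC R) (f g : nat -> CC R) (p : {poly CC R}).

Definition avg (N : nat) f : CC R := N%:R^-1 * \sum_(j < N) f j.

Lemma eq_avg N f g : f =1 g -> avg N f = avg N g.
Proof. by move=> h; rewrite /avg; congr (_ * _); apply: eq_bigr. Qed.

Lemma avgZ N c f : avg N (fun j => c * f j) = c * avg N f.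
Proof. by rewrite /avg -mulr_sumr mulrCA. Qed.

Lemma avgD N f g : avg N (fun j => f j + g j) = avg N f + avg N g.
Proof. by rewrite /avg big_split mulrDr. Qed.

Lemma avgB N f g : avg N (fun j => f j - g j) = avg N f - avg N g.
Proof. by rewrite /avg sumrB mulrBr. Qed.

Lemma avg_cst N c : (0 < N)%N -> avg N (fun=> c) = c.
Proof.
move=> N0; rewrite /avg sumr_const card_ord -[c *+ N]mulr_natl mulKf //.
by rewrite pnatr_eq0 -lt0n.
Qed.

Lemma avg_le N f (M : R) : 0 <= M -> (forall j, cmod (f j) <= M) ->
  cmod (avg N f) <= M.
Proof.
move=> M0 hf; rewrite /avg cmodM cmodV cmod_nat.
have [->|N0] := posnP N; first by rewrite big_ord0 cmod0 mulr0.
rewrite mulrC ler_pdivrMr ?ltr0n //; apply: le_trans (cmod_sum _ _ _) _.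
apply: (@le_trans _ _ (\sum_(j < N) M)); first by apply: ler_sum.
by rewrite sumr_const card_ord mulr_natr.
Qed.

Lemma avg_geom w : cmod w = 1 -> w != 1 -> cvgC (fun N => avg N (GRing.exp w)) 0.
Proof.
move=> w1 wn1 e e0.
have d0 : 0 < cmod (w - 1) by rewrite cmod_gt0 subr_eq0.
pose c := 2 / cmod (w - 1) / e.
have c0 : 0 <= c by rewrite !divr_ge0 // ltW.
exists (Num.bound c).+1 => N hN; rewrite subr0 /avg cmodM cmodV cmod_nat.
have N0 : (0 < N)%N by apply: leq_trans hN.
have cN : c < N%:R.
  by apply: lt_le_trans (archi_boundP c0) _; rewrite ler_nat ltnW.
have -> : \sum_(j < N) w ^+ j = (w ^+ N - 1) / (w - 1).
  by rewrite subrX1 mulrAC divff ?mul1r // subr_eq0.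
rewrite cmodM cmodV mulrCA -invfM ler_pdivrMr ?mulr_gt0 ?ltr0n //.
have : cmod (w ^+ N - 1) <= 2.
  by apply: le_trans (cmodD _ _) _; rewrite cmodN cmodX w1 expr1n cmod1; lra.
by move: cN; rewrite /c !ltr_pdivrMr //; lra.
Qed.

End Averages.

Section Rotation.
Variables (R : realType) (q : CC R).
Hypothesis q_unit : cmod q = 1.
Hypothesis q_free : forall k, (0 < k)%N -> q ^+ k != 1.
Implicit Types (z w : CC R) (p : {poly CC R}).

Lemma q_neq0 : q != 0.
Proof. by rewrite -cmod_eq0 q_unit oner_eq0. Qed.

Lemma cmod_qX n : cmod (q ^+ n) = 1.
Proof. by rewrite cmodX q_unit expr1n. Qed.

Lemma cmod_qXM n z : cmod (q ^+ n * z) = cmod z.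
Proof. by rewrite cmodM cmod_qX mul1r. Qed.

Lemma q_inj i k : q ^+ i = q ^+ k -> i = k.
Proof.
wlog ik : i k / (i <= k)%N.
  by move=> h; case/orP: (leq_total i k) => /h // + /esym => /[apply].
move=> h; apply/eqP; rewrite eqn_leq ik /= leqNgt; apply/negP => ik'.
have := @q_free (k - i); rewrite subn_gt0 => /(_ ik')/eqP; apply.
by apply: (mulfI (expf_neq0 i q_neq0)); rewrite -exprD subnKC // mulr1.
Qed.

(** Averages along an orbit of the rotation extract a coefficient in the limit,
    as integration against [z ^- k] over a circle does: each other monomial
    contributes a geometric sum of ratio different from [1]. *)
Lemma avg_poly p z k :
  cvgC (fun N => avg N (fun j => p.[q ^+ j * z] / (q ^+ j) ^+ k)) (p`_k * z ^+ k).
Proof.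
have mono c i : cvgC
    (fun N => avg N (fun j => c * (q ^+ j * z) ^+ i / (q ^+ j) ^+ k))
    (if i == k then c * z ^+ i else 0).
  have E j : c * (q ^+ j * z) ^+ i / (q ^+ j) ^+ k =
             c * z ^+ i * (q ^+ i / q ^+ k) ^+ j.
    by rewrite exprMn expr_div_n -!exprM !(mulnC j); ring.
  have -> : (fun N => avg N (fun j => c * (q ^+ j * z) ^+ i / (q ^+ j) ^+ k)) =
            (fun N => c * z ^+ i * avg N (GRing.exp (q ^+ i / q ^+ k))).
    by apply/funext => N; rewrite -avgZ; apply: eq_avg.
  case: eqVneq => [<-|ik].
    rewrite divff ?expf_neq0 ?q_neq0 // => e e0; exists 1%N => N N0.
    have -> : avg N (GRing.exp (1 : CC R)) = 1.
      by rewrite -[RHS](avg_cst _ N0); apply: eq_avg => j; rewrite expr1n.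
    by rewrite mulr1 subrr cmod0 ltW.
  rewrite -[0](mulr0 (c * z ^+ i)); apply: cvgCZ.
  apply: avg_geom; first by rewrite cmodM cmodV !cmod_qX divr1.
  apply: contra_neq ik => h; apply: q_inj.
  by rewrite -[LHS](divfK (expf_neq0 k q_neq0)) h mul1r.
have [n hn] : exists n, (size p <= n)%N by exists (size p).
have -> : (fun N => avg N (fun j => p.[q ^+ j * z] / (q ^+ j) ^+ k)) =
  (fun N => \sum_(i < n) avg N (fun j => p`_i * (q ^+ j * z) ^+ i / (q ^+ j) ^+ k)).
  apply/funext => N; rewrite /avg -mulr_sumr exchange_big /=.
  by congr (_ * _); apply: eq_bigr => j _; rewrite (horner_coef_wide _ hn) mulr_suml.
have -> : p`_k * z ^+ k = \sum_(i < n) (if i == k :> nat then p`_i * z ^+ i else 0).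
  rewrite -big_mkcond /=; case: (ltnP k n) => kn.
    by rewrite (big_pred1 (Ordinal kn)) // => i; rewrite -val_eqE.
  rewrite nth_default ?(leq_trans hn) // mul0r big1 // => i /eqP ik.
  by have := ltn_ord i; rewrite ik ltnNge kn.
elim: {hn}n => [|n IH].
  by rewrite big_ord0; under eq_fun do rewrite big_ord0; exact: cvgC_cst.
rewrite big_ord_recr /=; under eq_fun do rewrite big_ord_recr /=.
by apply: cvgCD => //; exact: mono.
Qed.

Lemma avg_poly0 p z : cvgC (fun N => avg N (fun j => p.[q ^+ j * z])) p.[0].
Proof.
have := avg_poly p z 0; rewrite expr0 mulr1 -horner_coef0.
by under eq_fun do under eq_avg do rewrite expr0 divr1.
Qed.

End Rotation.

(** * Uniform limits of polynomials on a disc *)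

Section UniformLimits.
Variable R : realType.
Implicit Types (z w c : CC R) (f g : CC R -> CC R) (p : {poly CC R}) (rho : R).

(** Stands in for functions holomorphic in the disc and continuous up to its
    boundary. *)
Definition poly_limit rho f := forall e : R, 0 < e ->
  exists p : {poly CC R}, forall z, cmod z <= rho -> cmod (f z - p.[z]) <= e.

Lemma poly_bounded rho p : 0 <= rho ->
  exists2 M : R, 0 <= M & forall z, cmod z <= rho -> cmod p.[z] <= M.
Proof.
move=> r0; elim/poly_ind: p => [|p c [M M0 hM]].
  by exists 0 => // z _; rewrite horner0 cmod0.
exists (M * rho + cmod c); first by rewrite addr_ge0 ?mulr_ge0 ?cmod_ge0.
move=> z hz; rewrite hornerMXaddC; apply: le_trans (cmodD _ _) _.
by rewrite lerD2r cmodM ler_pM ?cmod_ge0 ?hM.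
Qed.

Lemma poly_lipschitz rho p : 0 <= rho ->
  exists2 L : R, 0 <= L & forall z w, cmod z <= rho -> cmod w <= rho ->
    cmod (p.[z] - p.[w]) <= L * cmod (z - w).
Proof.
move=> r0; elim/poly_ind: p => [|p c [L L0 hL]].
  by exists 0 => // z w _ _; rewrite !horner0 subrr cmod0 mul0r.
have [M M0 hM] := poly_bounded p r0.
exists (L * rho + M); first by rewrite addr_ge0 ?mulr_ge0.
move=> z w hz hw; rewrite !hornerMXaddC.
have -> : p.[z] * z + c - (p.[w] * w + c) = (p.[z] - p.[w]) * z + p.[w] * (z - w).
  by ring.
apply: le_trans (cmodD _ _) _; rewrite !cmodM mulrDl lerD //.
  by rewrite mulrAC ler_pM ?cmod_ge0 ?hL.
by rewrite ler_wpM2r ?cmod_ge0 ?hM.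
Qed.

Lemma poly_limit_bounded rho f : 0 <= rho -> poly_limit rho f ->
  exists2 M : R, 0 < M & forall z, cmod z <= rho -> cmod (f z) <= M.
Proof.
move=> r0 hf; have [p hp] := hf 1 ltr01; have [M M0 hM] := poly_bounded p r0.
exists (1 + M); first by lra.
by move=> z hz; have := hp z hz; have := hM z hz;
  have := cmodD (f z - p.[z]) p.[z]; rewrite subrK; lra.
Qed.

Lemma poly_limit_ucont rho f : 0 <= rho -> poly_limit rho f ->
  forall e : R, 0 < e -> exists2 d : R, 0 < d &
    forall z w, cmod z <= rho -> cmod w <= rho -> cmod (z - w) <= d ->
      cmod (f z - f w) <= e.
Proof.
move=> r0 hf e e0; have e3 : 0 < e / 3 by lra.
have [p hp] := hf _ e3; have [L L0 hL] := poly_lipschitz p r0.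
have L1 : 0 < L + 1 by lra.
exists (e / 3 / (L + 1)); first by rewrite divr_gt0.
move=> z w hz hw; rewrite ler_pdivlMr // => hzw.
have h1 := hp z hz; have h2 := hp w hw; have h3 := hL z w hz hw.
have h4 := cmod_ge0 (z - w).
have := cmodB_le (f z) p.[z] (f w); have := cmodB_le p.[z] p.[w] (f w).
by rewrite [cmod (p.[w] - _)]cmodBC; nra.
Qed.

Definition cont_at f c := forall e : R, 0 < e -> exists2 d : R, 0 < d &
  forall z, cmod (z - c) < d -> cmod (f z - f c) <= e.

Lemma poly_limit_cont rho f w : poly_limit rho f -> cmod w < rho -> cont_at f w.
Proof.
move=> hf ar e e0; have r0 : 0 <= rho := le_trans (cmod_ge0 w) (ltW ar).
have [d d0 hd] := poly_limit_ucont r0 hf e0.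
exists (Num.min d (rho - cmod w)); first by rewrite lt_min d0 subr_gt0.
move=> z; rewrite lt_min => /andP[/ltW zd zr]; apply: hd => //; last exact: ltW.
by have := cmodD (z - w) w; rewrite subrK; lra.
Qed.

Lemma poly_limit_poly rho p : poly_limit rho (horner p).
Proof. by move=> e e0; exists p => z _; rewrite subrr cmod0 ltW. Qed.

Lemma poly_limitD rho f g :
  poly_limit rho f -> poly_limit rho g -> poly_limit rho (fun z => f z + g z).
Proof.
move=> hf hg e e0; have e2 : 0 < e / 2 by lra.
have [p hp] := hf _ e2; have [s hs] := hg _ e2; exists (p + s) => z hz.
rewrite hornerD opprD addrACA.
by have := cmodD (f z - p.[z]) (g z - s.[z]); have := hp z hz; have := hs z hz; lra.
Qed.

Lemma poly_limitM rho f g : 0 <= rho ->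
  poly_limit rho f -> poly_limit rho g -> poly_limit rho (fun z => f z * g z).
Proof.
move=> r0 hf hg e e0; have [M M0 hM] := poly_limit_bounded r0 hg.
have [|p hp] := hf (e / 2 / M); first by rewrite !divr_gt0.
have [K K0 hK] := poly_bounded p r0.
have K1 : 0 < K + 1 by lra.
have [|s hs] := hg (e / 2 / (K + 1)); first by rewrite !divr_gt0.
exists (p * s) => z hz; rewrite hornerM.
have -> : f z * g z - p.[z] * s.[z] = (f z - p.[z]) * g z + p.[z] * (g z - s.[z]).
  by ring.
apply: le_trans (cmodD _ _) _; rewrite !cmodM [leRHS](splitr e) lerD //.
  rewrite -[leRHS](divfK (lt0r_neq0 M0)).
  by rewrite ler_pM ?cmod_ge0 ?hM ?hp.
rewrite mulrC -[leRHS](divfK (lt0r_neq0 K1)).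
by rewrite ler_pM ?cmod_ge0 ?hs // (le_trans (hK z hz)) //; lra.
Qed.

Lemma poly_limit_exp rho f n : 0 <= rho -> poly_limit rho f ->
  poly_limit rho (fun z => f z ^+ n).
Proof.
move=> r0 hf; elim: n => [|n IH].
  have := poly_limit_poly rho 1; congr poly_limit.
  by apply/funext => z; rewrite hornerC expr0.
have := poly_limitM r0 hf IH; congr poly_limit.
by apply/funext => z; rewrite exprS.
Qed.

Lemma poly_limit_scale rho f c : cmod c = 1 ->
  poly_limit rho f -> poly_limit rho (fun z => f (c * z)).
Proof.
move=> c1 hf e e0; have [p hp] := hf _ e0; exists (p \Po (c *: 'X)) => z hz.
by rewrite horner_comp !hornerE hp // cmodM c1 mul1r.
Qed.

Lemma poly_limit_conj rho f :
  poly_limit rho f -> poly_limit rho (fun z => (f (z^*)%C)^*%C).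
Proof.
move=> hf e e0; have [p hp] := hf _ e0.
exists (map_poly (@conjc R) p) => z hz.
have -> : (map_poly (@conjc R) p).[z] = (p.[z^*%C])^*%C.
  by rewrite -horner_map /= conjcK.
by rewrite -raddfB cmod_conj hp // cmod_conj.
Qed.

Lemma poly_limit_cauchy rho (s : nat -> {poly CC R}) :
  (forall e : R, 0 < e -> exists N, forall m n, (N <= m)%N -> (N <= n)%N ->
     forall z, cmod z <= rho -> cmod ((s m).[z] - (s n).[z]) <= e) ->
  exists2 f, poly_limit rho f &
    forall z, cmod z <= rho -> cvgC (fun n => (s n).[z]) (f z).
Proof.
move=> hs.
have /choice[f hf] z : exists l, cmod z <= rho -> cvgC (fun n => (s n).[z]) l.
  have [hz|hz] := boolP (cmod z <= rho); last by exists 0.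
  have [e e0|l hl] := @cvgC_cauchy R (fun n => (s n).[z]).
    by have [N hN] := hs e e0; exists N => m n hm hn; exact: hN.
  by exists l.
exists f => // e e0; have [N hN] := hs e e0; exists (s N) => z hz.
by apply: cvgC_le (hf z hz) _; exists N => n hn; exact: hN.
Qed.

Lemma poly_limit_seq rho f : poly_limit rho f ->
  exists s : nat -> {poly CC R}, forall e : R, 0 < e ->
    exists N, forall n, (N <= n)%N -> forall z, cmod z <= rho ->
      cmod (f z - (s n).[z]) <= e.
Proof.
move=> hf; have h n : exists p, forall z, cmod z <= rho ->
    cmod (f z - p.[z]) <= n.+1%:R^-1.
  by apply: hf; rewrite invr_gt0 ltr0n.
have /choice[s hs] := h; exists s => e e0.
exists (Num.bound e^-1) => n hn z hz; apply: le_trans (hs n z hz) _.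
rewrite invf_ple ?posrE ?ltr0n //.
have ei : 0 <= e^-1 by rewrite invr_ge0 ltW.
by apply: ltW; apply: lt_trans (archi_boundP ei) _; rewrite ltr_nat ltnS.
Qed.

Section Rotated.
Variable q : CC R.
Hypothesis q_unit : cmod q = 1.
Hypothesis q_free : forall k, (0 < k)%N -> q ^+ k != 1.

Lemma avg_poly_limit rho f z : poly_limit rho f -> cmod z <= rho ->
  cvgC (fun N => avg N (fun j => f (q ^+ j * z))) (f 0).
Proof.
move=> hf hz e e0; have e3 : 0 < e / 3 by lra.
have [p hp] := hf _ e3.
have [N hN] := avg_poly0 q_unit q_free p z e3.
exists N => n /hN {}hN.
have h0 : cmod (f 0 - p.[0]) <= e / 3.
  by apply: hp; rewrite cmod0 (le_trans (cmod_ge0 z)).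
have h1 : cmod (avg n (fun j => f (q ^+ j * z)) - avg n (fun j => p.[q ^+ j * z]))
    <= e / 3.
  rewrite -avgB; apply: avg_le; first exact: ltW.
  by move=> j; apply: hp; rewrite cmod_qXM.
have := cmodB_le (avg n (fun j => f (q ^+ j * z))) (avg n (fun j => p.[q ^+ j * z])) (f 0).
have := cmodB_le (avg n (fun j => p.[q ^+ j * z])) p.[0] (f 0).
by rewrite [cmod (p.[0] - _)]cmodBC; lra.
Qed.

Lemma poly_limit_center rho f z (M : R) : poly_limit rho f -> cmod z <= rho ->
  (forall j, cmod (f (q ^+ j * z)) <= M) -> cmod (f 0) <= M.
Proof.
move=> hf hz hM; rewrite -[f 0]subr0; apply: cvgC_le (avg_poly_limit hf hz) _.
exists 0%N => N _; rewrite subr0; apply: avg_le => //.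
exact: le_trans (cmod_ge0 _) (hM 0%N).
Qed.

(** The averages along an orbit are all [f z], and tend to [f 0]. *)
Lemma poly_limit_invariant rho f z : poly_limit rho f -> cmod z <= rho ->
  (forall w, cmod w <= rho -> f (q * w) = f w) -> f z = f 0.
Proof.
move=> hf hz hinv; apply: (@cvgC_uniq R (fun N => avg N (fun j => f (q ^+ j * z)))).
  have E j : f (q ^+ j * z) = f z.
    elim: j => [|j <-]; first by rewrite expr0 mul1r.
    by rewrite exprS -mulrA hinv // cmod_qXM.
  by move=> e e0; exists 1%N => N N0; rewrite (eq_avg _ E) avg_cst // subrr cmod0 ltW.
exact: avg_poly_limit hf hz.
Qed.

(** The mean value property, at a centre other than the origin. *)
Lemma poly_center p z0 c (M : R) :
  (forall j, cmod p.[z0 + q ^+ j * c] <= M) -> cmod p.[z0] <= M.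
Proof.
move=> hM.
have := @poly_limit_center (cmod c) (horner (p \Po ('X + z0%:P))) c M
  (poly_limit_poly _ _) (lexx _).
rewrite !horner_comp !hornerE; apply=> j.
by rewrite horner_comp !hornerE addrC.
Qed.

End Rotated.

End UniformLimits.

(** * Orders of zeros *)

Section Orders.
Variable R : realType.
Implicit Types (z w c : CC R) (f g : CC R -> CC R) (p : {poly CC R}) (rho : R).

Lemma exp_small (t : R) : 0 <= t -> t < 1 -> forall e : R, 0 < e ->
  exists N, forall n, (N <= n)%N -> t ^+ n <= e.
Proof.
move=> t0 t1 e e0; have t1' : `|t| < 1 by rewrite ger0_norm.
have /cvgrPdist_le /(_ e e0) [N _ hN] := cvg_expr t1'.
exists N => n /hN; rewrite sub0r normrN ger0_norm // exprn_ge0 //.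
Qed.

(** Two-sided bounds are all that is used of a zero of order [k]; unlike a
    factorization they pass through rotations and conjugation for free. *)
Definition order_at f c (k : nat) := exists (d a b : R),
  [/\ 0 < d, 0 < a, 0 < b & forall z, cmod (z - c) < d ->
      a * cmod (z - c) ^+ k <= cmod (f z) <= b * cmod (z - c) ^+ k].

Lemma order_atM f g c k l :
  order_at f c k -> order_at g c l -> order_at (fun z => f z * g z) c (k + l).
Proof.
move=> [d [a [b [d0 a0 b0 h]]]] [d' [a' [b' [d0' a0' b0' h']]]].
exists (Num.min d d'), (a * a'), (b * b'); split; rewrite ?mulr_gt0 //.
  by rewrite lt_min d0.
move=> z; rewrite lt_min => /andP[/h /andP[h1 h2] /h' /andP[h1' h2']].
have X m : 0 <= cmod (z - c) ^+ m by rewrite exprn_ge0 // cmod_ge0.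
rewrite cmodM exprD (mulrACA a) (mulrACA b); apply/andP; split.
  by rewrite ler_pM // mulr_ge0 // ltW.
by rewrite ler_pM ?cmod_ge0.
Qed.

Lemma order_at_rotate f c u k : cmod u = 1 ->
  order_at f (u * c) k -> order_at (fun z => f (u * z)) c k.
Proof.
move=> u1 [d [a [b [d0 a0 b0 h]]]]; exists d, a, b; split=> // z hz.
have E : cmod (u * z - u * c) = cmod (z - c) by rewrite -mulrBr cmodM u1 mul1r.
by have := h (u * z); rewrite E; exact.
Qed.

Lemma order_at_unrotate f c u k : cmod u = 1 ->
  order_at (fun z => f (u * z)) c k -> order_at f (u * c) k.
Proof.
move=> u1 h; have u0 : u != 0 by rewrite -cmod_eq0 u1 oner_eq0.
have := @order_at_rotate (fun z => f (u * z)) (u * c) u^-1 k.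
rewrite cmodV u1 invr1 mulKf // => /(_ erefl h).
by under eq_fun do rewrite mulVKf //.
Qed.

Lemma order_at_conj f c k :
  order_at f (c^*)%C k -> order_at (fun z => (f (z^*)%C)^*%C) c k.
Proof.
move=> [d [a [b [d0 a0 b0 h]]]]; exists d, a, b; split=> // z hz.
have E : cmod ((z^*)%C - (c^*)%C) = cmod (z - c) by rewrite -raddfB cmod_conj.
by have := h (z^*)%C; rewrite E cmod_conj; exact.
Qed.

Lemma order_at_factor f g c k (d : R) : 0 < d ->
  cont_at g c -> g c != 0 -> (forall z, cmod (z - c) < d -> f z = (z - c) ^+ k * g z) ->
  order_at f c k.
Proof.
move=> d0 hg gc hf; rewrite -cmod_gt0 in gc.
have [|d' d0' hd'] := hg (cmod (g c) / 2); first by lra.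
exists (Num.min d d'), (cmod (g c) / 2), (2 * cmod (g c)); split; try lra.
  by rewrite lt_min d0.
move=> z; rewrite lt_min => /andP[/hf -> /hd' h].
have X : 0 <= cmod (z - c) ^+ k by rewrite exprn_ge0 // cmod_ge0.
rewrite cmodM cmodX [_ * cmod (g z)]mulrC.
apply/andP; split; rewrite ler_wpM2r //.
  by have := cmod_lower (g c) (g z); rewrite [cmod (g c - _)]cmodBC; lra.
by have := cmod_lower (g z) (g c); lra.
Qed.

Section Rotated.
Variable q : CC R.
Hypothesis q_unit : cmod q = 1.
Hypothesis q_free : forall k, (0 < k)%N -> q ^+ k != 1.

(** Within [delta] of [w0] the bound comes from the mean value over a circle of
    radius [2 * delta], which stays [delta] away from [w0]. *)
Lemma poly_quotient_bound rho p w0 (delta B : R) : 0 < delta ->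
  cmod w0 + 3 * delta <= rho ->
  (forall z, cmod z <= rho -> cmod (p.[z] * (z - w0)) <= B) ->
  forall z, cmod z <= rho -> cmod p.[z] <= B / delta.
Proof.
move=> d0 hd hp.
have far z : cmod z <= rho -> delta <= cmod (z - w0) -> cmod p.[z] <= B / delta.
  move=> hz h; rewrite ler_pdivlMr //; apply: le_trans (hp z hz).
  by rewrite cmodM ler_wpM2l ?cmod_ge0.
move=> z hz; have [|near] := leP delta (cmod (z - w0)); first exact: far.
apply: (poly_center q_unit q_free (c := (2 * delta)%:C%C)) => j.
have E : cmod (q ^+ j * (2 * delta)%:C%C) = 2 * delta.
  by rewrite cmod_qXM // cmod_pos //; lra.
set y := q ^+ j * _ in E *; apply: far.
  have := cmodD (z + y - w0) w0; have := cmodD (z - w0) y.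
  by rewrite subrK addrAC E; lra.
have := cmodD (z + y - w0) (- (z - w0)).
have -> : z + y - w0 - (z - w0) = y by ring.
by rewrite cmodN E; lra.
Qed.

(** The singularity is removable because the difference quotients at [w0] of
    polynomials approximating [f] form a Cauchy sequence, uniformly on the disc. *)
Lemma poly_limit_div rho f w0 : poly_limit rho f -> cmod w0 < rho -> f w0 = 0 ->
  exists2 g, poly_limit rho g & forall z, cmod z <= rho -> f z = (z - w0) * g z.
Proof.
move=> hf hw f0; have [s hs] := poly_limit_seq hf.
have /choice[Q hQ] n : exists Q, s n - ((s n).[w0])%:P = Q * ('X - w0%:P).
  by apply/factor_theorem/rootP; rewrite hornerD hornerN hornerC subrr.
have hQz n z : (Q n).[z] * (z - w0) = (s n).[z] - (s n).[w0].
  have := congr1 (fun p => p.[z]) (hQ n).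
  by rewrite hornerM hornerXsubC hornerD hornerN hornerC => <-.
pose delta := (rho - cmod w0) / 3.
have d0 : 0 < delta by rewrite /delta; lra.
have hd : cmod w0 + 3 * delta <= rho by rewrite /delta; lra.
have [e e0|g hg hgz] := @poly_limit_cauchy _ rho Q.
  have [|N hN] := hs (e * delta / 4); first by rewrite divr_gt0 ?ltr0n // mulr_gt0.
  exists N => m n hm hn z hz; rewrite -hornerN -hornerD.
  rewrite -[e](mulfK (lt0r_neq0 d0)).
  apply: (poly_quotient_bound d0 hd) hz => {}z hz.
  have -> : (Q m - Q n).[z] * (z - w0) =
    (f w0 - (s m).[w0]) + ((f z - (s n).[z]) - (f w0 - (s n).[w0]) - (f z - (s m).[z])).
    by rewrite hornerD hornerN mulrBl !hQz; ring.
  have b1 := hN m hm z hz; have b2 := hN n hn z hz.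
  have b3 := hN m hm w0 (ltW hw); have b4 := hN n hn w0 (ltW hw).
  apply: le_trans (cmodD _ _) _; apply: le_trans (lerD b3 (cmodD _ _)) _.
  by have := cmodD (f z - (s n).[z]) (- (f w0 - (s n).[w0])); rewrite !cmodN; lra.
exists g => // z hz; have cs w : cmod w <= rho -> cvgC (fun n => (s n).[w]) (f w).
  move=> hw' e e0; have [N hN] := hs e e0.
  by exists N => n hn; rewrite cmodBC; exact: hN.
have := cvgCB (cs z hz) (cs w0 (ltW hw)); rewrite f0 subr0.
under eq_fun do rewrite -hQz mulrC.
move=> h; apply: cvgC_uniq h _; exact: cvgCZ (hgz z hz).
Qed.

(** A zero of order at least [k] at [w0] leaves [f z = (z - w0) ^ k * g z].  On
    the circle of radius [rho], the factor [rho - w0^* z / rho] has the same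
    modulus as [z - w0], so that replacing the latter by the former keeps [f]
    bounded there, while the value at the origin is multiplied by
    [(rho / |w0|) ^ k]: the mean value property bounds [k]. *)
Lemma finite_order rho f w0 : poly_limit rho f -> cmod w0 < rho -> f 0 != 0 ->
  exists k, order_at f w0 k.
Proof.
move=> hf hw f0; have r0 : 0 < rho := le_lt_trans (cmod_ge0 _) hw.
apply: contrapT => nord.
have step k : exists2 g, poly_limit rho g &
    forall z, cmod z <= rho -> f z = (z - w0) ^+ k * g z.
  elim: k => [|k [g hg hfg]]; first by exists f => // z _; rewrite expr0 mul1r.
  have [gw|gw] := eqVneq (g w0) 0.
    have [g' hg' hgg'] := poly_limit_div hg hw gw.
    by exists g' => // z hz; rewrite hfg // hgg' // exprSr mulrA.
  exfalso; apply: nord; exists k.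
  have dw : 0 < rho - cmod w0 by lra.
  have inD z : cmod (z - w0) < rho - cmod w0 -> cmod z <= rho.
    by have := cmodD (z - w0) w0; rewrite subrK; lra.
  apply: (order_at_factor dw) gw _ => [|z /inD]; last exact: hfg.
  exact: poly_limit_cont hg hw.
have [M M0 hM] := poly_limit_bounded (ltW r0) hf.
have [|||k hk] := @exp_small (cmod w0 / rho) _ _ (cmod (f 0) / 2 / M).
- by rewrite divr_ge0 ?cmod_ge0 // ltW.
- by rewrite ltr_pdivrMr // mul1r.
- by rewrite !divr_gt0 // cmod_gt0.
have {}hk := hk k (leqnn k); have [g hg hfg] := step k.
pose P : {poly CC R} := (rho%:C%C)%:P - ((w0^*)%C / rho%:C%C) *: 'X.
have rC : rho%:C%C != 0 :> CC R by rewrite -cmod_eq0 cmod_pos ?lt0r_neq0 // ltW.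
have hF := poly_limitM (ltW r0) hg (poly_limit_exp k (ltW r0) (poly_limit_poly rho P)).
have zr : cmod (rho%:C%C : CC R) <= rho by rewrite cmod_pos // ltW.
have := poly_limit_center q_unit q_free (M := M) hF zr.
have -> : P.[0] = rho%:C%C.
  by rewrite /P hornerD hornerN hornerC hornerZ hornerX mulr0 subr0.
rewrite cmodM cmodX (cmod_pos (ltW r0)) => H.
have {}H : cmod (g 0) * rho ^+ k <= M.
  apply: H => j; set u := q ^+ j.
  have u1 : u * (u^*)%C = 1 by rewrite mulC_conj cmod_qX // expr1n.
  have EP : cmod P.[u * rho%:C%C] = cmod (u * rho%:C%C - w0).
    rewrite -[RHS]cmod_conj -[LHS]mul1r -[X in X * _](cmod_qX q_unit j) -cmod_conj -/u -cmodM.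
    congr cmod; rewrite /P hornerD hornerN hornerC hornerZ hornerX.
    rewrite conjB conjM conjc_real.
    have -> : (u^*)%C * (rho%:C%C - (w0^*)%C / rho%:C%C * (u * rho%:C%C)) =
      (u^*)%C * rho%:C%C - (w0^*)%C * (u * (u^*)%C) * (rho%:C%C / rho%:C%C) by ring.
    by rewrite u1 divff // !mulr1.
  have ur : cmod (u * rho%:C%C) <= rho by rewrite cmod_qXM.
  by rewrite cmodM cmodX EP mulrC -cmodX -cmodM -hfg // hM.
have F0 : cmod (f 0) = cmod w0 ^+ k * cmod (g 0).
  by rewrite hfg ?cmod0 ?ltW // sub0r cmodM cmodX cmodN.
have : cmod (f 0) <= (cmod w0 / rho) ^+ k * M.
  rewrite F0 expr_div_n -mulrA ler_wpM2l ?exprn_ge0 ?cmod_ge0 //.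
  by rewrite mulrC ler_pdivlMr // exprn_gt0.
have := ler_wpM2r (ltW M0) hk; rewrite divfK ?lt0r_neq0 //.
by move: f0; rewrite -cmod_gt0; lra.
Qed.

End Rotated.

End Orders.

(** * A local Hurwitz theorem for polynomials *)

Section Hurwitz.
Variable R : realType.
Implicit Types (z w c a u x : CC R) (f g : CC R -> CC R) (rs : seq (CC R)) (rho : R).

Lemma unity_roots N : (0 < N)%N ->
  exists2 r : seq (CC R), size r = N &
    (forall s, s \in r -> cmod s = 1) /\
    forall x, \prod_(s <- r) (x - s) = x ^+ N - 1.
Proof.
move=> N0; have [r hr] := closed_field_poly_normal ('X^N - 1 : {poly CC R}).
have hm : 'X^N - 1 \is @monic (CC R) by rewrite monicXnsubC.
rewrite (monicP hm) scale1r in hr.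
exists r; first by have := congr1 (size \o val) hr; rewrite /= size_XnsubC // size_prod_XsubC => -[].
split=> [s hs|x].
  have : root ('X^N - 1) s by rewrite hr root_prod_XsubC.
  rewrite rootE !hornerE subr_eq0 => /eqP h.
  by apply/eqP; rewrite -(eqrXn2 N0) ?cmod_ge0 // -cmodX h cmod1 expr1n.
have := congr1 (fun p => p.[x]) hr; rewrite horner_prod.
under eq_bigr do rewrite hornerXsubC.
by move=> <-; rewrite !hornerE.
Qed.

Lemma le_of_pow (A M K : R) : 0 <= A -> 0 <= M -> 0 < K ->
  (forall N, (0 < N)%N -> M ^+ N <= K * A ^+ N) -> M <= A.
Proof.
move=> A0 M0 K0 h; rewrite leNgt; apply/negP => AM.
have M1 : 0 < M by apply: le_lt_trans AM.
have [|||N hN] := @exp_small R (A / M) _ _ (K^-1 / 2).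
- by rewrite divr_ge0.
- by rewrite ltr_pdivrMr // mul1r.
- by rewrite divr_gt0 // invr_gt0.
have := hN N.+1 (leqnSn N); have := h N.+1 isT.
rewrite expr_div_n ler_pdivrMr ?exprn_gt0 //.
move=> h1 h2; have := ler_wpM2l (ltW K0) h2.
have -> : K * (K^-1 / 2 * M ^+ N.+1) = M ^+ N.+1 / 2.
  by rewrite !mulrA divff ?lt0r_neq0 // mul1r mulrC.
have : 0 < M ^+ N.+1 by rewrite exprn_gt0.
by lra.
Qed.

(** Minimum principle.  The product of the values at [z + rho * s], over the
    [N]-th roots of unity [s], is [lc ^ N] times the product of the
    [rho ^ N - (x - z) ^ N], hence at most [2 ^ (size rs)] times the [N]-th power of
    the value at [z]; the constant disappears as [N] grows. *)
Lemma min_principle rs lc z rho (M : R) : 0 < rho -> 0 <= M ->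
  (forall x, x \in rs -> rho <= cmod (x - z)) ->
  (forall u, cmod u = rho -> M <= cmod (lc * \prod_(x <- rs) (z + u - x))) ->
  M <= cmod (lc * \prod_(x <- rs) (z - x)).
Proof.
move=> r0 M0 hrs hM.
apply: (@le_of_pow _ _ (2 ^+ size rs)); rewrite ?cmod_ge0 ?exprn_gt0 //.
move=> N N0; have [r sr [hr1 hr2]] := unity_roots N0.
have hr s : s \in r -> M <= cmod (lc * \prod_(x <- rs) (z + rho%:C%C * s - x)).
  by move=> hs; apply: hM; rewrite cmodM cmod_pos ?ltW // hr1 // mulr1.
have circ x : \prod_(s <- r) cmod (z + rho%:C%C * s - x) =
    cmod ((x - z) ^+ N - (rho%:C%C) ^+ N).
  have rC : rho%:C%C != 0 :> CC R by rewrite -cmod_eq0 cmod_pos ?lt0r_neq0 // ltW.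
  have -> : (x - z) ^+ N - (rho%:C%C) ^+ N =
      (rho%:C%C) ^+ N * \prod_(s <- r) ((x - z) / rho%:C%C - s).
    by rewrite hr2 mulrBr mulr1 expr_div_n [_ * (_ / _)]mulrC divfK // expf_neq0.
  rewrite cmodM cmodX cmod_prod -{1}sr.
  have -> : cmod (rho%:C%C) ^+ size r = \prod_(s <- r) cmod (rho%:C%C : CC R).
    by rewrite big_const_seq count_predT -Monoid.iteropE.
  rewrite -big_split; apply: eq_bigr => s _ /=.
  rewrite -cmodM mulrBr [_ * (_ / _)]mulrC divfK // -[LHS]cmodN; congr cmod; ring.
have -> : M ^+ N = \prod_(s <- r) M.
  by rewrite big_const_seq count_predT sr -Monoid.iteropE.
apply: (@le_trans _ _ (\prod_(s <- r) cmod (lc * \prod_(x <- rs) (z + rho%:C%C * s - x)))).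
  rewrite !big_seq; apply: ler_prod => s hs; rewrite M0 /=; exact: hr.
under eq_bigr do rewrite cmodM cmod_prod.
rewrite big_split /= exchange_big /=; under [X in _ * X]eq_bigr do rewrite circ.
rewrite big_const_seq count_predT sr -Monoid.iteropE cmodM exprMn cmod_prod mulrCA.
rewrite ler_wpM2l ?exprn_ge0 ?cmod_ge0 //.
have -> : 2 ^+ size rs * (\prod_(x <- rs) cmod (z - x)) ^+ N =
    \prod_(x <- rs) (2 * cmod (x - z) ^+ N).
  rewrite big_split /= big_const_seq count_predT -Monoid.iteropE prodrXl.
  by congr (_ * _ ^+ _); apply: eq_bigr => x _; rewrite cmodBC.
rewrite !big_seq; apply: ler_prod => x hx; rewrite cmod_ge0 /=.
apply: le_trans (cmodD _ _) _; rewrite cmodN !cmodX (cmod_pos (ltW r0)).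
have : rho ^+ N <= cmod (x - z) ^+ N by rewrite lerXn2r ?nnegrE ?cmod_ge0 ?hrs // ltW.
by lra.
Qed.

Section Rotated.
Variable q : CC R.
Hypothesis q_unit : cmod q = 1.
Hypothesis q_free : forall k, (0 < k)%N -> q ^+ k != 1.

(** Up to unimodular weights, averages of the values on the circle of radius [eta]
    tend to the leading term, of modulus [eta ^ size rs]. *)
Lemma monic_large rs a (eta : R) : 0 < eta ->
  exists2 u, cmod u = eta & eta ^+ size rs / 2 <= cmod (\prod_(x <- rs) (a + u - x)).
Proof.
move=> e0; have eX : 0 < eta ^+ size rs by rewrite exprn_gt0.
apply: contrapT => hno.
pose p := \prod_(x <- rs) ('X - (x - a)%:P).
have := avg_poly q_unit q_free p (eta%:C%C) (size rs).
have -> : p`_(size rs) = 1.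
  have := monicP (monic_prod_XsubC rs predT (fun x => x - a)).
  rewrite /lead_coef -/p.
  by rewrite (size_prod_XsubC rs (fun x => x - a)).
rewrite mul1r => h.
suff : eta ^+ size rs <= eta ^+ size rs / 2 by lra.
rewrite -{1}(cmod_pos (ltW e0)) -cmodX -[X in cmod X]subr0.
apply: cvgC_le h _; exists 0%N => N _; rewrite subr0.
apply: avg_le; first by lra.
move=> j; rewrite cmodM cmodV cmodX cmod_qX // expr1n invr1 mulr1.
rewrite leNgt; apply/negP => hj; apply: hno.
exists (q ^+ j * eta%:C%C); first by rewrite cmod_qXM // cmod_pos // ltW.
apply: le_trans (ltW hj) _; rewrite /p horner_prod le_eqVlt; apply/orP; left.
by apply/eqP; congr cmod; apply: eq_bigr => x _; rewrite hornerXsubC; ring.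
Qed.

(** With fewer than [k] roots near [a], the polynomial could not be as small
    near [a] as [f]: on a circle around [a] it is bounded below like [f], the
    minimum principle propagates this bound inwards for the factor carrying the
    other roots, and the factor carrying the nearby roots is somewhere of size
    [eta ^ (k - 1)] on the circle of radius [eta], where [f] is of size
    [eta ^ k]. *)
Lemma hurwitz_local f a k : order_at f a k -> forall eps : R, 0 < eps ->
  exists2 delta : R, 0 < delta & forall lc rs,
    (forall z, cmod (z - a) < eps ->
       cmod (lc * \prod_(x <- rs) (z - x) - f z) <= delta) ->
    (k <= count (fun x => (cmod (x - a) < eps)%R) rs)%N.
Proof.
case: k => [|k]; first by move=> _ eps _; exists 1.
move=> [d [a0 [b [d0 a00 b0 hf]]]] eps eps0.
pose e := Num.min eps d.
have e0 : 0 < e by rewrite lt_min eps0.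
have le_e_eps : e <= eps by rewrite ge_min lexx.
have le_e_d : e <= d by rewrite ge_min lexx orbT.
(* [2 * A] bounds [|f|] from below on the points at distance at least [e / 4]
   from [a]. *)
pose A := a0 * (e / 4) ^+ k.+1 / 2.
have A0 : 0 < A by rewrite divr_gt0 // mulr_gt0 // exprn_gt0 // divr_gt0.
(* On the circle of radius [eta = t * (2 * e)], the upper bound for [|f|] is
   [B * t ^ k.+1], to be small against the lower bound [A * t ^ k / 2] that fewer
   than [k.+1] nearby roots would give for the polynomial. *)
pose B := b * (2 * e) ^+ k.+1.
have B0 : 0 < B by rewrite mulr_gt0 // exprn_gt0 // mulr_gt0.
pose t := Num.min (8^-1) (A / 8 / B).
have t0 : 0 < t.
  by rewrite lt_min; apply/andP; split; [lra | apply: divr_gt0 => //; lra].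
have t8 : t <= 8^-1 by rewrite ge_min lexx.
have tB : B * t <= A / 8 by rewrite (mulrC B) -ler_pdivlMr // /t ge_min lexx orbT.
have tk0 : 0 < t ^+ k by rewrite exprn_gt0.
exists (Num.min A (A * t ^+ k / 8)).
  by rewrite lt_min A0 /=; have := mulr_gt0 A0 tk0; lra.
move=> lc rs hp.
pose P := fun x => cmod (x - a) < e.
apply: (@leq_trans (count P rs)); last first.
  by apply: sub_count => x /lt_le_trans; exact.
rewrite leqNgt; apply/negP; rewrite ltnS => jk.
pose n1 := [seq x <- rs | P x]; pose n2 := [seq x <- rs | ~~ P x].
have sn1 : size n1 = count P rs by rewrite size_filter.
have split_p z : lc * \prod_(x <- rs) (z - x) =
    \prod_(x <- n1) (z - x) * (lc * \prod_(x <- n2) (z - x)).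
  by rewrite (bigID P) /= /n1 /n2 !big_filter mulrCA.
have [u hu hun] := monic_large n1 a (mulr_gt0 t0 (mulr_gt0 (ltr0n R 2) e0)).
have ue : cmod u <= e / 4 by rewrite hu; nra.
have Ej : 0 < (2 * e) ^+ count P rs by rewrite exprn_gt0 // mulr_gt0.
have hn2 : A / (2 * e) ^+ count P rs <= cmod (lc * \prod_(x <- n2) (a + u - x)).
  (* As [|u| <= e / 4], the circle of radius [e / 2] around [a + u] stays between
     the distances [e / 4] and [3 * e / 4] from [a]. *)
  apply: (@min_principle _ _ _ (e / 2)); first by lra.
  - by rewrite divr_ge0 ?ltW.
  - move=> x; rewrite mem_filter /= /P -leNgt => /andP[hx _].
    have := cmodD (x - (a + u)) u.
    have -> : x - (a + u) + u = x - a by ring.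
    by lra.
  - move=> v hv; set w := a + u + v.
    have wa : w - a = u + v by rewrite /w; ring.
    have w1 : cmod (w - a) <= 3 * e / 4 by rewrite wa; have := cmodD u v; lra.
    have w2 : e / 4 <= cmod (w - a).
      by rewrite wa addrC; have := cmodD (v + u) (- u); rewrite addrK cmodN; lra.
    have wd : cmod (w - a) < d by lra.
    have we : cmod (w - a) < eps by lra.
    have /andP[f1 _] := hf w wd.
    have : (e / 4) ^+ k.+1 <= cmod (w - a) ^+ k.+1.
      by rewrite lerXn2r ?nnegrE ?cmod_ge0 //; lra.
    rewrite -(ler_pM2l a00) => f2.
    have := hp w we; rewrite le_min => /andP[hp1 _].
    have pA : A <= cmod (lc * \prod_(x <- rs) (w - x)).
      have := cmod_lower (f w) (lc * \prod_(x <- rs) (w - x)).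
      by rewrite cmodBC /A in hp1 *; lra.
    rewrite ler_pdivrMr // mulrC; apply: le_trans pA _.
    rewrite split_p cmodM ler_wpM2r ?cmod_ge0 // cmod_prod -sn1.
    have -> : (2 * e) ^+ size n1 = \prod_(x <- n1) (2 * e).
      by rewrite big_const_seq count_predT -Monoid.iteropE.
    rewrite !big_seq; apply: ler_prod => x; rewrite mem_filter cmod_ge0 /= /P => /andP[hx _].
    by have := cmodB_le w a x; rewrite [cmod (a - x)]cmodBC; lra.
have ua : a + u - a = u by ring.
have ud : cmod (a + u - a) < d by rewrite ua; lra.
have ueps : cmod (a + u - a) < eps by rewrite ua; lra.
have /andP[_ f2] := hf _ ud.
have := hp _ ueps; rewrite le_min => /andP[_ hp2].
have up : cmod (lc * \prod_(x <- rs) (a + u - x)) <= A * t ^+ k / 4.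
  have := cmod_lower (lc * \prod_(x <- rs) (a + u - x)) (f (a + u)).
  have : b * cmod (a + u - a) ^+ k.+1 <= A * t ^+ k / 8.
    have -> : b * cmod (a + u - a) ^+ k.+1 = B * t * t ^+ k.
      by rewrite ua hu exprMn exprSr /B; ring.
    by have := ler_wpM2r (ltW tk0) tB; lra.
  by lra.
have lo : A * t ^+ count P rs / 2 <= cmod (lc * \prod_(x <- rs) (a + u - x)).
  rewrite split_p cmodM.
  have -> : A * t ^+ count P rs / 2 =
      (t * (2 * e)) ^+ size n1 / 2 * (A / (2 * e) ^+ count P rs).
    by rewrite sn1 exprMn; field; rewrite lt0r_neq0.
  have te0 : 0 < (t * (2 * e)) ^+ size n1 by rewrite exprn_gt0 // !mulr_gt0.
  by apply: ler_pM => //; [lra | rewrite ltW // divr_gt0].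
have tj : t ^+ k <= t ^+ count P rs.
  by rewrite ler_wiXn2l // ?ltW //; lra.
have := ler_wpM2l (ltW A0) tj; have := mulr_gt0 A0 tk0.
by lra.
Qed.

End Rotated.

End Hurwitz.

(** * Power series *)

Section PowerSeriesLimits.
Variable R : realType.
Implicit Types (a : nat -> CC R) (z w : CC R) (rho : R).

Lemma cpseriesS a z n : cpseries a z n.+1 = cpseries a z n + a n * z ^+ n.
Proof. by rewrite /cpseries /series /= big_nat_recr. Qed.

Lemma cpseries_poly a z n : cpseries a z n = (\poly_(j < n) a j).[z].
Proof. by rewrite horner_poly /cpseries /series /= big_mkord. Qed.

Lemma geometric_tail (t : R) m n : 0 <= t -> t < 1 -> (n <= m)%N ->
  \sum_(n <= j < m) t ^+ j <= t ^+ n / (1 - t).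
Proof.
move=> t0 t1 nm; rewrite ler_pdivlMr ?subr_gt0 //.
apply: (@le_trans _ _ (t ^+ n - t ^+ m)); last first.
  by have : 0 <= t ^+ m by [apply: exprn_ge0]; lra.
elim: m nm => [|m IH]; first by rewrite leqn0 => /eqP ->; rewrite big_nil mul0r subrr.
rewrite leq_eqVlt => /orP[/eqP <-|].
  by rewrite big_geq // mul0r subrr.
rewrite ltnS => nm; rewrite big_nat_recr //= mulrDl exprS.
by have := IH nm; lra.
Qed.

Lemma pseries_terms_bounded a z : cvgn (cpseries a z) ->
  exists2 B : R, 0 < B & forall j, cmod (a j * z ^+ j) <= B.
Proof.
move=> /cvgC_cvgn h; have [N hN] := h 1 ltr01.
exists (2 + \sum_(j < N) cmod (a j * z ^+ j)).
  by apply: ltr_wpDr => //; apply: sumr_ge0 => j _; exact: cmod_ge0.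
move=> j; have [Nj|jN] := leqP N j.
  have h1 := hN j Nj; have h2 := hN j.+1 (leqW Nj).
  apply: ler_wpDr; first by apply: sumr_ge0 => i _; exact: cmod_ge0.
  have := cmodB_le (cpseries a z j.+1) (limn (cpseries a z)) (cpseries a z j).
  have -> : a j * z ^+ j = cpseries a z j.+1 - cpseries a z j.
    by rewrite cpseriesS addrAC subrr add0r.
  by rewrite [cmod (limn _ - _)]cmodBC; lra.
rewrite (bigD1 (Ordinal jN)) //=.
have : 0 <= \sum_(i < N | i != Ordinal jN) cmod (a i * z ^+ i).
  by apply: sumr_ge0 => i _; exact: cmod_ge0.
by lra.
Qed.

Definition pseries_uniform a rho := forall e : R, 0 < e ->
  exists N, forall n, (N <= n)%N -> forall z, cmod z <= rho ->
    cmod (limn (cpseries a z) - cpseries a z n) <= e.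

Lemma pseries_ucvg a z1 rho : cvgn (cpseries a z1) -> 0 <= rho -> rho < cmod z1 ->
  pseries_uniform a rho.
Proof.
move=> /pseries_terms_bounded[B B0 hB] r0 rz.
have z10 : 0 < cmod z1 := le_lt_trans r0 rz.
pose t := rho / cmod z1.
have t0 : 0 <= t by rewrite divr_ge0 // ltW.
have t1 : t < 1 by rewrite ltr_pdivrMr // mul1r.
have term z j : cmod z <= rho -> cmod (a j * z ^+ j) <= B * t ^+ j.
  move=> hz; rewrite expr_div_n mulrA ler_pdivlMr ?exprn_gt0 //.
  rewrite cmodM mulrAC -cmodX -cmodM; apply: ler_pM; rewrite ?cmod_ge0 ?hB //.
  by rewrite cmodX lerXn2r ?nnegrE ?cmod_ge0.
have tail z m n : cmod z <= rho -> (n <= m)%N ->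
    cmod (cpseries a z m - cpseries a z n) <= B * (t ^+ n / (1 - t)).
  move=> hz nm; rewrite /cpseries /series /= (big_cat_nat (leq0n n) nm) /= addrAC subrr add0r.
  apply: le_trans (cmod_sum _ _ _) _.
  apply: (@le_trans _ _ (\sum_(n <= j < m) B * t ^+ j)).
    by apply: ler_sum => j _; exact: term.
  by rewrite -mulr_sumr; apply: ler_wpM2l; [exact: ltW | exact: geometric_tail].
have small e : 0 < e -> exists N, forall n, (N <= n)%N -> B * (t ^+ n / (1 - t)) <= e.
  move=> e0; have [|N hN] := exp_small t0 t1 (e := e * (1 - t) / B).
    by rewrite divr_gt0 // mulr_gt0 // subr_gt0.
  exists N => n /hN; rewrite ler_pdivlMr // mulrA ler_pdivrMr ?subr_gt0 //.
  by rewrite mulrC.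
move=> e e0; have [N hN] := small e e0; exists N => n hn z hz.
have [e' e0'|l hl] := @cvgC_cauchy R (cpseries a z).
  have [N' hN'] := small e' e0'.
  exists N' => i j hi hj; have [ij|/ltnW ij] := leqP i j.
    by rewrite cmodBC; apply: le_trans (tail z j i hz ij) (hN' i hi).
  by apply: le_trans (tail z i j hz ij) (hN' j hj).
rewrite (cvgC_lim hl); apply: cvgC_le hl _.
by exists n => m hm; apply: le_trans (tail z m n hz hm) (hN n hn).
Qed.

End PowerSeriesLimits.

(** * The functional equation of G and its conjugate *)

Section RogersRamanujanFunction.
Variables (R : realType) (q : CC R).
Hypothesis q_unit : cmod q = 1.
Hypothesis q_free : forall k, (0 < k)%N -> q ^+ k != 1.
Implicit Types (z w : CC R).

Lemma G_coefS j : G_coef q j.+1 * (1 - q ^+ j.+1) = q ^+ j.*2.+1 * G_coef q j.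
Proof.
have h k : (0 < k)%N -> 1 - q ^+ k != 0.
  by move=> k0; rewrite subr_eq0 eq_sym q_free.
rewrite /G_coef big_nat_recr //= invfM -mulrA divfK ?h //.
rewrite mulrA -exprD; congr (q ^+ _ / _).
by rewrite -mul2n; lia.
Qed.

Lemma cpseries_G n w :
  cpseries (G_coef q) w n.+1 - cpseries (G_coef q) (q * w) n.+1 =
  q * w * cpseries (G_coef q) (q * (q * w)) n.
Proof.
elim: n => [|n IH].
  by rewrite !cpseriesS /cpseries /series /= !big_geq // !expr0 mulr0 subrr.
rewrite cpseriesS [X in _ - X]cpseriesS opprD addrACA IH.
rewrite [in RHS]cpseriesS mulrDr; congr (_ + _).
have -> : G_coef q n.+1 * w ^+ n.+1 - G_coef q n.+1 * (q * w) ^+ n.+1 =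
  G_coef q n.+1 * (1 - q ^+ n.+1) * w ^+ n.+1 by rewrite exprMn; ring.
by rewrite G_coefS !exprMn -addnn !exprS exprD; ring.
Qed.

(** The function [G] for the parameter [q^-1 = q^*]. *)
Definition Gconj z : CC R := (G q (z^*)%C)^*%C.

Section InDisc.
Variable rho : R.
Hypothesis rho_ge0 : 0 <= rho.
Hypothesis G_ucvg : pseries_uniform (G_coef q) rho.

Lemma G_cvg z : cmod z <= rho -> cvgC (cpseries (G_coef q) z) (G q z).
Proof.
move=> hz e e0; have [N hN] := G_ucvg e0.
by exists N => n hn; rewrite cmodBC; exact: hN.
Qed.

Lemma G_poly_limit : poly_limit rho (G q).
Proof.
move=> e e0; have [N hN] := G_ucvg e0; exists (\poly_(j < N) G_coef q j) => z hz.
by rewrite -cpseries_poly; exact: hN.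
Qed.

Lemma Gconj_poly_limit : poly_limit rho Gconj.
Proof. exact: poly_limit_conj G_poly_limit. Qed.

Lemma G0 : G q 0 = 1.
Proof.
apply: cvgC_lim => e e0; exists 1%N => -[//|n] _.
suff -> : cpseries (G_coef q) 0 n.+1 = 1 by rewrite subrr cmod0 ltW.
elim: n => [|n IH]; last by rewrite cpseriesS IH exprS mul0r mulr0 addr0.
rewrite cpseriesS /cpseries /series /= big_geq // add0r expr0 mulr1.
by rewrite /G_coef big_geq // expr0 divr1.
Qed.

Lemma Gconj0 : Gconj 0 = 1.
Proof. by rewrite /Gconj conjc0 G0 conjc1. Qed.

Lemma cmod_qM z : cmod (q * z) = cmod z.
Proof. by rewrite cmodM q_unit mul1r. Qed.

Lemma G_feq w : cmod w <= rho -> G q w = G q (q * w) + q * w * G q (q * (q * w)).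
Proof.
move=> hw; apply/eqP; rewrite addrC -subr_eq; apply/eqP.
have shift u z : cvgC u z -> cvgC (fun n => u n.+1) z.
  by move=> h e e0; have [N hN] := h e e0; exists N => n hn; rewrite hN // leqW.
have := cvgCB (shift _ _ (G_cvg hw)) (shift _ _ (G_cvg (z := q * w) _)).
rewrite cmod_qM => /(_ hw) h; apply: cvgC_uniq h _.
under eq_fun do rewrite cpseries_G.
by apply: cvgCZ; apply: G_cvg; rewrite !cmod_qM.
Qed.

Lemma q_conj : q * (q^*)%C = 1.
Proof. by rewrite mulC_conj q_unit expr1n. Qed.

Lemma Gconj_feq w : cmod w <= rho ->
  Gconj (q * (q * w)) = Gconj (q * w) + q * w * Gconj w.
Proof.
move=> hw; rewrite /Gconj G_feq; last by rewrite cmod_conj !cmod_qM.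
have E z : q * ((q * z)^*)%C = (z^*)%C by rewrite conjM mulrA q_conj mul1r.
have -> (x y : CC R) : ((x + y)^*)%C = (x^*)%C + (y^*)%C.
  exact: (raddfD (@conjc R)).
by rewrite !E (conjM ((q * w)^*)%C) conjcK.
Qed.

(** A Casoratian of the two solutions [G (q ^ n z)] and [Gconj (q ^ n z)] of
    mutually adjoint recurrences: it is invariant under [z |-> q z], hence
    constant. *)
Lemma G_casoratian z : cmod z <= rho ->
  G q (q * z) * Gconj (q * z) + q * z * Gconj z * G q (q * (q * z)) = 1.
Proof.
pose W z := G q (q * z) * Gconj (q * z) + q * z * Gconj z * G q (q * (q * z)).
have W0 : W 0 = 1 by rewrite /W !mulr0 !mul0r G0 Gconj0 addr0 mulr1.
move=> hz; rewrite -W0 -/(W z).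
have lG := G_poly_limit; have lC := Gconj_poly_limit.
apply: (poly_limit_invariant q_unit q_free _ hz) => [|w hw].
  have lX : poly_limit rho (fun x => q * x).
    have := poly_limit_poly rho (q *: 'X); congr poly_limit.
    by apply/funext => x; rewrite hornerZ hornerX.
  have l1 := poly_limitM rho_ge0 (poly_limit_scale q_unit lG) (poly_limit_scale q_unit lC).
  have l2 := poly_limitM rho_ge0 (poly_limitM rho_ge0 lX lC)
    (poly_limit_scale q_unit (poly_limit_scale q_unit lG)).
  exact: poly_limitD l1 l2.
have hqw : cmod (q * w) <= rho by rewrite cmod_qM.
rewrite /W (Gconj_feq hw) [in RHS](G_feq hqw).
generalize (Gconj (q * w)) (Gconj w) (G q (q * (q * w))) (G q (q * (q * (q * w)))).
by move=> a b c d; ring.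
Qed.

(** With the value [0] put before [nu 0 = 1], the recurrence starts one step
    earlier, where the closed formula below holds trivially. *)
Definition nu_shift m : {poly CC R} := if m is n.+1 then nu q n else 0.

Lemma nu_shiftSS m :
  nu_shift m.+2 = nu_shift m.+1 + q ^+ m.+1 *: 'X * nu_shift m.
Proof. by case: m => [|m] //=; rewrite mulr0 addr0. Qed.

Lemma size_nu_shift m : (size (nu_shift m) <= m)%N.
Proof.
suff : (size (nu_shift m) <= m)%N && (size (nu_shift m.+1) <= m.+1)%N by case/andP.
elim: m => [|m IH].
  apply/andP; split.
    by rewrite size_poly0.
  by rewrite size_poly1.
have /andP[h1 h2] := IH.
rewrite h2 nu_shiftSS /=; apply: leq_trans (size_polyD _ _) _.
rewrite geq_max (leq_trans h2) //= -scalerAl.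
apply: leq_trans (size_scale_leq _ _) _.
by rewrite mulrC; apply: leq_trans (size_polyMleq _ _) _; rewrite size_polyX addn2 /= ltnS ltnW.
Qed.

(** Both terms on the right solve the three-term recurrence of [nu]; they agree at
    [m = 0], and the Casoratian identity gives the case [m = 1]. *)
Lemma nu_shift_formula m z : cmod z <= rho ->
  (nu_shift m).[z] = G q (q * z) * Gconj (q ^+ m * z) -
    (- z) ^+ m * (\prod_(i < m) q ^+ i.+1) * Gconj z * G q (q * (q ^+ m * z)).
Proof.
move=> hz.
suff : (nu_shift m).[z] = G q (q * z) * Gconj (q ^+ m * z) -
    (- z) ^+ m * (\prod_(i < m) q ^+ i.+1) * Gconj z * G q (q * (q ^+ m * z)) /\
  (nu_shift m.+1).[z] = G q (q * z) * Gconj (q ^+ m.+1 * z) -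
    (- z) ^+ m.+1 * (\prod_(i < m.+1) q ^+ i.+1) * Gconj z *
      G q (q * (q ^+ m.+1 * z)) by case.
elim: m => [|m [IH1 IH2]].
  split.
    by rewrite [LHS]horner0 big_ord0 !expr0 !mul1r; ring.
  rewrite [LHS]hornerC big_ord_recr big_ord0 /= !expr1 mul1r -[LHS](G_casoratian hz).
  by rewrite mulNr !mulNr opprK [z * q]mulrC.
split; first exact: IH2.
rewrite nu_shiftSS hornerD hornerM hornerZ hornerX IH1 IH2.
rewrite (big_ord_recr m.+1) (big_ord_recr m) /=.
set P := \prod_(i < m) _.
have e1 : q ^+ m.+1 * z = q * (q ^+ m * z) by rewrite exprS mulrA.
have e2 : q ^+ m.+2 * z = q * (q * (q ^+ m * z)) by rewrite !exprS !mulrA.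
have hw : cmod (q ^+ m * z) <= rho by rewrite cmod_qXM.
rewrite e1 e2 (Gconj_feq hw).
have := G_feq (w := q * (q ^+ m * z)); rewrite cmod_qM => /(_ hw) ->.
generalize (G q (q * z)) (Gconj z) (Gconj (q * (q ^+ m * z))) (Gconj (q ^+ m * z)).
generalize (G q (q * (q * (q ^+ m * z)))) (G q (q * (q * (q * (q ^+ m * z))))) P.
by move=> a b p c d e f; rewrite !exprS; ring.
Qed.

(** If [rho > 1], divide the formula for [nu_shift m] by [z ^ m] and average
    over the circle of radius [rho]: the polynomial contributes nothing, since its
    degree is less than [m]; the first product becomes [O(rho ^ -m)]; the
    second one has a mean of modulus [Gconj 0 * G 0 = 1]. *)
Lemma radius_le1 : rho <= 1.
Proof.
rewrite leNgt; apply/negP => r1; have r0 : 0 < rho by lra.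
have lG := G_poly_limit; have lC := Gconj_poly_limit.
have [M M0 hM] := poly_limit_bounded rho_ge0 lG.
have hMc z : cmod z <= rho -> cmod (Gconj z) <= M.
  by move=> hz; rewrite /Gconj cmod_conj hM // cmod_conj.
have [|||m hm] := @exp_small R rho^-1 _ _ (2^-1 / (M * M)).
- by rewrite invr_ge0.
- by rewrite invf_lt1.
- by rewrite divr_gt0 ?mulr_gt0 // invr_gt0.
have {}hm := hm m (leqnn m).
pose z : CC R := rho%:C%C.
have zr : cmod z = rho by rewrite cmod_pos.
have z0 : z != 0 by rewrite -cmod_eq0 zr lt0r_neq0.
have hz : cmod z <= rho by rewrite zr.
pose P := \prod_(i < m) q ^+ i.+1.
have P1 : cmod P = 1 by rewrite cmod_prod big1 // => i _; rewrite cmod_qX.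
pose F w := Gconj w * G q (q * (q ^+ m * w)).
have F0 : F 0 = 1 by rewrite /F !mulr0 G0 Gconj0 mulr1.
have lF : poly_limit rho F.
  exact: (poly_limitM rho_ge0 lC (poly_limit_scale (cmod_qX q_unit m)
    (poly_limit_scale q_unit lG))).
have c1 := avg_poly_limit q_unit q_free lF hz.
have c2 := avg_poly q_unit q_free (nu_shift m) z m.
have {c2} := cvgCZ ((- z) ^+ m * P)^-1 c2.
rewrite nth_default ?size_nu_shift // mul0r mulr0 => c2.
have key j : cmod (F (q ^+ j * z) + ((- z) ^+ m * P)^-1 *
    ((nu_shift m).[q ^+ j * z] / (q ^+ j) ^+ m)) <= 2^-1.
  set w := q ^+ j * z.
  have hw : cmod w <= rho by rewrite cmod_qXM.
  have c0 : (- z) ^+ m * P != 0.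
    by rewrite mulf_neq0 ?expf_neq0 ?oppr_eq0 // -cmod_eq0 P1 oner_neq0.
  have qj0 : (q ^+ j) ^+ m != 0 by rewrite !expf_neq0 // (q_neq0 q_unit).
  have -> : F w + ((- z) ^+ m * P)^-1 * ((nu_shift m).[w] / (q ^+ j) ^+ m) =
      ((- z) ^+ m * P)^-1 / (q ^+ j) ^+ m * (G q (q * w) * Gconj (q ^+ m * w)).
    rewrite nu_shift_formula // -/P.
    have -> : (- w) ^+ m = (q ^+ j) ^+ m * (- z) ^+ m by rewrite -exprMn mulrN.
    rewrite /F; move: c0 qj0.
    generalize ((- z) ^+ m) ((q ^+ j) ^+ m) P (G q (q * w)) (G q (q * (q ^+ m * w))).
    generalize (Gconj w) (Gconj (q ^+ m * w)) => a b A B P' c d.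
    rewrite mulf_eq0 negb_or => /andP[A0 P0] B0.
    by field; rewrite A0 P0 B0.
  rewrite !cmodM !cmodV !cmodM !cmodX cmodN zr P1 q_unit !expr1n !mulr1.
  rewrite invr1 mulr1 -exprVn.
  apply: le_trans (_ : rho^-1 ^+ m * (M * M) <= _).
    rewrite ler_wpM2l ?exprn_ge0 ?invr_ge0 //.
    by apply: ler_pM; rewrite ?cmod_ge0 ?hM ?hMc // ?cmod_qM ?cmod_qXM.
  by rewrite -ler_pdivlMr ?mulr_gt0.
have := cvgC_le (w := 0) (c := 2^-1) (cvgCD c1 c2).
rewrite addr0 subr0 F0 cmod1; suff h : exists N, forall n, (N <= n)%N ->
  cmod (avg n (fun j => F (q ^+ j * z)) + ((- z) ^+ m * P)^-1 *
    avg n (fun j => (nu_shift m).[q ^+ j * z] / (q ^+ j) ^+ m) - 0) <= 2^-1.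
  by move=> /(_ h); lra.
exists 0%N => n _; rewrite subr0 -avgZ -avgD.
by apply: avg_le => [|j]; [lra | exact: key].
Qed.

End InDisc.

End RogersRamanujanFunction.

(** * Poles *)

Section Poles.
Variable R : realType.
Implicit Types (f g : CC R -> CC R) (a z c x : CC R) (p : {poly CC R}).

Lemma holomorphic_at_cont g a : holomorphic_at g a -> cont_at g a.
Proof.
move=> /nbhs_singleton /derivable1_diffP /differentiable_continuous /cvgrPdist_le h e e0.
have [|d d0 hd] := (near_cmodP a _).1 (h e%:C%C _); first by rewrite ltcR.
by exists d => // z /hd; rewrite distrC cmodE lecR.
Qed.

Lemma pole_unbounded f a k : pole_of_order f a k -> forall B d : R, 0 < d ->
  exists2 z, cmod (z - a) < d & B < cmod (f z).
Proof.
move=> [k0 [g [hg ga /dnbhs_cmodP[d1 d10 hd1]]]] B d d0.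
rewrite -cmod_gt0 in ga; set y := cmod (g a) in ga.
have [d2 d20 hd2] := holomorphic_at_cont hg (divr_gt0 ga (ltr0n R 2)).
pose b := Num.max B 0 + 1.
have b0 : 0 < b by rewrite /b; have : 0 <= Num.max B 0; [rewrite le_max lexx orbT | lra].
have Bb : B < b by rewrite /b; have : B <= Num.max B 0; [rewrite le_max lexx | lra].
pose h := Num.min (Num.min d (Num.min d1 d2)) (Num.min 1 (y / 2 / b)) / 2.
have h0 : 0 < h by rewrite divr_gt0 // !lt_min d0 d10 d20 ltr01 !divr_gt0.
have hh : h < Num.min (Num.min d (Num.min d1 d2)) (Num.min 1 (y / 2 / b)).
  by rewrite /h in h0 *; lra.
move: hh; rewrite !lt_min => /andP[/andP[hd /andP[h1 h2]] /andP[h11 hb]].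
pose z := a + h%:C%C.
have za : cmod (z - a) = h by rewrite /z addrAC subrr add0r cmod_pos // ltW.
exists z; first by rewrite za.
have -> : f z = g z / (z - a) ^+ k.
  by apply: hd1; rewrite ?za // -subr_eq0 -cmod_eq0 za lt0r_neq0.
rewrite cmodM cmodV cmodX za; apply: (lt_le_trans Bb).
rewrite ler_pdivlMr ?exprn_gt0 //.
have hk : h ^+ k <= h.
  by case: k k0 {hd1} => // k _; rewrite exprS ger_pMr // exprn_ile1 // ltW.
have := ler_wpM2l (ltW b0) hk.
move: hb; rewrite ltr_pdivlMr // => hb.
have := hd2 z; rewrite za => /(_ h2).
have := cmod_lower (g a) (g z); rewrite cmodBC -/y; lra.
Qed.

Lemma poly_cont p a : cont_at (horner p) a.
Proof.
by apply: (poly_limit_cont (poly_limit_poly (cmod a + 1) p)); rewrite ltrDl.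
Qed.

Lemma derivable_poly p a : derivable (horner p) a 1.
Proof.
elim/poly_ind: p => [|p c IH].
  have -> : horner (0 : {poly CC R}) = cst 0 by apply/funext => z; rewrite horner0.
  exact: derivable_cst.
have -> : horner (p * 'X + c%:P) = (fun z => p.[z] * z + c).
  by apply/funext => z; rewrite hornerMXaddC.
have h := @derivableM (CC R) (CC R : normedModType (CC R)) (horner p) id a 1 IH
  (@derivable_id (CC R) (CC R : normedModType (CC R)) a 1).
exact: (@derivableD (CC R) (CC R : normedModType (CC R)) (CC R : normedModType (CC R))
  (fun z => p.[z] * z) (cst c) a 1 h
  (@derivable_cst (CC R) (CC R : normedModType (CC R)) (CC R : normedModType (CC R)) c a 1)).
Qed.

Lemma holomorphic_quotient p (s : {poly CC R}) a : s.[a] != 0 ->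
  holomorphic_at (fun z => p.[z] / s.[z]) a.
Proof.
rewrite -cmod_gt0 => sa; apply/near_cmodP.
have [|d d0 hd] := poly_cont s a (e := cmod s.[a] / 2); first by lra.
exists d => // z /hd h; have sz : s.[z] != 0.
  by rewrite -cmod_gt0; have := cmod_lower s.[a] s.[z]; rewrite cmodBC; lra.
have := @derivableV (CC R) (CC R : normedModType (CC R)) (horner s) z 1 sz
  (@derivable_poly s z).
move/(@derivableM (CC R) (CC R : normedModType (CC R)) (horner p) _ z 1
  (@derivable_poly p z)); exact.
Qed.

Lemma prod_sub_split rs (lc a z : CC R) :
  lc * \prod_(x <- rs) (z - x) =
  (z - a) ^+ count_mem a rs * (lc * \prod_(x <- rs | x != a) (z - x)).
Proof.
rewrite (bigID (pred1 a)) /= mulrCA; congr (_ * _).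
rewrite (eq_bigr (fun=> z - a)) => [|x /eqP -> //].
by rewrite -big_filter big_const_seq count_predT size_filter -Monoid.iteropE.
Qed.

Lemma sum_count_undup (T : eqType) (t : seq T) :
  (\sum_(a <- undup t) count_mem a t)%N = size t.
Proof.
rewrite -sum1_size -(big_undup_iterop_count _ t xpredT (fun=> 1%N)).
by apply: eq_bigr => a _; rewrite Monoid.iteropE iter_addn_0 mul1n.
Qed.

(** At a root [a] of [s] the factors other than [z - a] are absorbed in the
    holomorphic part, and the number of equal factors is the order of the pole;
    at any other point the quotient stays bounded. *)
Lemma quotient_poles p s lc rs (U : set (CC R)) : lc != 0 ->
  s = lc *: \prod_(x <- rs) ('X - x%:P) ->
  (forall z, s.[z] = 0 -> p.[z] != 0) ->
  total_pole_multiplicity (fun z => p.[z] / s.[z]) U (count (fun x => x \in U) rs).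
Proof.
move=> lc0 hs hps.
have sE z : s.[z] = lc * \prod_(x <- rs) (z - x).
  by rewrite hs hornerZ horner_prod; congr (_ * _); apply: eq_bigr => x _; rewrite hornerXsubC.
exists (undup [seq x <- rs | x \in U]), (fun a => count_mem a rs); split.
- exact: undup_uniq.
- move=> a; rewrite mem_undup mem_filter => /andP[/set_mem Ua ars]; split=> //.
  split; first by rewrite -has_count has_pred1.
  pose Q := lc *: \prod_(x <- rs | x != a) ('X - x%:P).
  have QE z : Q.[z] = lc * \prod_(x <- rs | x != a) (z - x).
    by rewrite hornerZ horner_prod; congr (_ * _); apply: eq_bigr => x _; rewrite hornerXsubC.
  have Qa : Q.[a] != 0.
    rewrite QE mulf_neq0 // prodf_seq_neq0; apply/allP => x _.
    by apply/implyP; rewrite subr_eq0 eq_sym.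
  have sa : s.[a] = 0.
    rewrite sE (prod_sub_split _ _ a) subrr expr0n.
    by rewrite (eqn0Ngt (count_mem a rs)) -has_count has_pred1 ars /= mul0r.
  exists (fun z => p.[z] / Q.[z]); split.
  + exact: holomorphic_quotient.
  + by rewrite mulf_neq0 ?invr_neq0 // hps.
  + by apply: nearW => z; rewrite sE (prod_sub_split _ _ a) -QE invfM mulrA mulrAC.
- move=> a k Ua hpole; rewrite mem_undup mem_filter mem_set //=.
  apply: contrapT => /negP ars; have sa : s.[a] != 0.
    rewrite sE mulf_neq0 // prodf_seq_neq0; apply/allP => x xrs /=.
    by rewrite subr_eq0; apply: contraNneq ars => ->.
  rewrite -cmod_gt0 in sa.
  have [|d d0 hd] := poly_cont s a (e := cmod s.[a] / 2); first by lra.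
  have [d' d0' hd'] := poly_cont p a ltr01.
  have dd : 0 < Num.min d d' by rewrite lt_min d0.
  have [z] := pole_unbounded hpole ((cmod p.[a] + 1) / (cmod s.[a] / 2)) dd.
  rewrite lt_min => /andP[/hd h1 /hd' h2]; rewrite cmodM cmodV.
  have s2 : cmod s.[a] / 2 <= cmod s.[z].
    by have := cmod_lower s.[a] s.[z]; rewrite cmodBC; lra.
  have p2 : cmod p.[z] <= cmod p.[a] + 1.
    by have := cmod_lower p.[z] p.[a]; lra.
  apply/negP; rewrite -leNgt; apply: ler_pM => //; rewrite ?cmod_ge0 ?invr_ge0 ?cmod_ge0 //.
  by rewrite lef_pV2 ?posrE //; lra.
- rewrite -size_filter -sum_count_undup [LHS]big_seq [RHS]big_seq.
  apply: eq_bigr => a; rewrite mem_undup mem_filter => /andP[Ua _].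
  rewrite count_filter; apply: eq_count => x /=.
  by case: eqP => //= ->; rewrite Ua.
Qed.

(** The denominator vanishes at [a], as the quotient would be bounded otherwise;
    then [f] does not, and solving [f z / g z = h z / (z - a) ^ k] for [g z]
    bounds it on both sides. *)
Lemma quotient_pole_order f g a k : cont_at f a -> cont_at g a ->
  (g a = 0 -> f a != 0) -> pole_of_order (fun z => f z / g z) a k -> order_at g a k.
Proof.
move=> cf cg fga hpole.
have ga0 : g a = 0.
  apply: contrapT => /eqP; rewrite -cmod_gt0 => ga.
  have [|d d0 hd] := cg (cmod (g a) / 2); first by lra.
  have [d' d0' hd'] := cf 1 ltr01.
  have dd : 0 < Num.min d d' by rewrite lt_min d0.
  have [z] := pole_unbounded hpole ((cmod (f a) + 1) / (cmod (g a) / 2)) dd.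
  rewrite lt_min => /andP[/hd h1 /hd' h2]; rewrite cmodM cmodV.
  apply/negP; rewrite -leNgt; apply: ler_pM; rewrite ?invr_ge0 ?cmod_ge0 //.
    by have := cmod_lower (f z) (f a); lra.
  have := cmod_lower (g a) (g z); rewrite cmodBC => h3.
  by rewrite lef_pV2 ?posrE //; lra.
have fa : 0 < cmod (f a) by rewrite cmod_gt0 fga.
have [k0 [h [hh ha /dnbhs_cmodP[d1 d10 hd1]]]] := hpole.
rewrite -cmod_gt0 in ha.
have [|d2 d20 hd2] := holomorphic_at_cont hh (e := cmod (h a) / 2); first by lra.
have [|d3 d30 hd3] := cf (cmod (f a) / 2); first by lra.
exists (Num.min d1 (Num.min d2 d3)), (cmod (f a) / 2 / (2 * cmod (h a))),
  (2 * cmod (f a) / (cmod (h a) / 2)).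
split; [by rewrite !lt_min d10 d20 | by rewrite !divr_gt0 ?mulr_gt0 |
        by rewrite !divr_gt0 ?mulr_gt0 |].
move=> z; rewrite !lt_min => /andP[z1 /andP[/hd2 b1 /hd3 b2]].
have [->|za] := eqVneq z a.
  by rewrite ga0 cmod0 subrr cmod0 expr0n eqn0Ngt k0 !mulr0 lexx.
have c1 := cmod_lower (h a) (h z); have c2 := cmod_lower (h z) (h a).
have c3 := cmod_lower (f a) (f z); have c4 := cmod_lower (f z) (f a).
rewrite cmodBC in c1; rewrite cmodBC in c3.
have X0 : 0 < cmod (z - a) ^+ k by rewrite exprn_gt0 // cmod_gt0 subr_eq0.
have := congr1 (@cmod R) (hd1 z z1 za); rewrite !cmodM !cmodV cmodX.
have hz0 : 0 < cmod (h z) by lra.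
have fz0 : 0 < cmod (f z) by lra.
move: (cmod_ge0 (g z)); rewrite le_eqVlt => /orP[/eqP <-|g0].
  rewrite invr0 mulr0 => /esym/eqP; rewrite mulf_eq0 invr_eq0.
  by rewrite (gt_eqF hz0) (gt_eqF X0).
move=> E; have -> : cmod (g z) = cmod (f z) / cmod (h z) * cmod (z - a) ^+ k.
  have -> : cmod (f z) = cmod (h z) / cmod (z - a) ^+ k * cmod (g z).
    by rewrite -E divfK // lt0r_neq0.
  by field; rewrite !lt0r_neq0.
rewrite !ler_pM2r //; apply/andP; split.
  by apply: ler_pM; rewrite ?invr_ge0 ?lef_pV2 ?posrE //; lra.
by apply: ler_pM; rewrite ?invr_ge0 ?lef_pV2 ?posrE //; lra.
Qed.

End Poles.

Section RogersRamanujanPoles.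
Variables (R : realType) (q : CC R).
Hypothesis q_unit : cmod q = 1.
Hypothesis q_free : forall k, (0 < k)%N -> q ^+ k != 1.
Implicit Types (z a : CC R).

Lemma nu_at0 n : (nu q n).[0] = 1.
Proof.
suff : (nu q n).[0] = 1 /\ (nu q n.+1).[0] = 1 by case.
elim: n => [|n [h1 h2]]; first by split; rewrite hornerC.
split; first exact: h2.
have -> : nu q n.+2 = nu q n.+1 + q ^+ n.+2 *: 'X * nu q n by [].
by rewrite hornerD hornerM hornerZ hornerX h2 mulr0 mul0r addr0.
Qed.

(** The Casoratian of the two solutions [mu] and [nu] of the recurrence is a
    nonzero multiple of [z ^ n.+1]. *)
Lemma mu_nu_coprime n z : (nu q n).[z] = 0 -> (mu q n).[z] != 0.
Proof.
have [->|z0] := eqVneq z 0; first by rewrite nu_at0 => /eqP; rewrite oner_eq0.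
move=> hnu; apply/eqP => hmu.
have : (mu q n.+1).[z] * (nu q n).[z] - (mu q n).[z] * (nu q n.+1).[z] != 0.
  elim: {hnu hmu} n => [|n IH].
    have -> : mu q 1 = 1 + q *: 'X by [].
    have -> : mu q 0 = 1 by [].
    have -> : nu q 0 = 1 by [].
    have -> : nu q 1 = 1 by [].
    rewrite hornerD hornerZ hornerX hornerC !mulr1 addrC addrA addNr add0r.
    by rewrite mulf_neq0 // (q_neq0 q_unit).
  have -> : nu q n.+2 = nu q n.+1 + q ^+ n.+2 *: 'X * nu q n by [].
  have -> : mu q n.+2 = mu q n.+1 + q ^+ n.+2 *: 'X * mu q n by [].
  rewrite !hornerD !hornerM !hornerZ !hornerX; move: IH.
  move: (mu q n.+1).[z] (mu q n).[z] (nu q n.+1).[z] (nu q n).[z] => a b c d IH.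
  have -> : (a + q ^+ n.+2 * z * b) * c - a * (c + q ^+ n.+2 * z * d) =
     - (q ^+ n.+2 * z) * (a * d - b * c) by ring.
  by rewrite mulf_neq0 // oppr_eq0 mulf_neq0 // expf_neq0 // (q_neq0 q_unit).
by rewrite hnu hmu mulr0 mul0r subrr eqxx.
Qed.

Lemma convergent_poles n lc rs (U : set (CC R)) :
  nu q n = lc *: \prod_(x <- rs) ('X - x%:P) ->
  total_pole_multiplicity (convergent q n) U (count (fun x => x \in U) rs).
Proof.
move=> hs; apply: (quotient_poles _ _ hs); last exact: mu_nu_coprime.
apply/eqP => lc0; have := nu_at0 n.
by rewrite hs lc0 scale0r horner0 => /esym/eqP; rewrite oner_eq0.
Qed.

(** At a pole of [H] the denominator [G (q z)] vanishes and hence, by the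
    Casoratian identity, the numerator does not. *)
Lemma H_pole_order rho a k : 0 <= rho ->
  pseries_uniform (G_coef q) rho ->
  cmod a < rho -> pole_of_order (H q) a k ->
  order_at (fun z => G q (q * z)) a k.
Proof.
move=> r0 hG ar hpole; have lG := G_poly_limit hG.
apply: quotient_pole_order hpole.
- exact: poly_limit_cont lG ar.
- exact: poly_limit_cont (poly_limit_scale q_unit lG) ar.
- move=> Gqa; have qb : q * (q^-1 * a) = a.
    by rewrite mulrA divff ?mul1r // (q_neq0 q_unit).
  have br : cmod (q^-1 * a) <= rho by rewrite cmodM cmodV q_unit invr1 mul1r ltW.
  have := G_casoratian q_unit q_free r0 hG br; rewrite qb Gqa mulr0 addr0 => h.
  by apply/eqP => h0; move: h; rewrite h0 mul0r => /esym/eqP; rewrite oner_eq0.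
Qed.

End RogersRamanujanPoles.

(** * The rotation by an irrational angle *)

Section UnitCircle.
Variable R : realType.
Implicit Types (t x y tau : R).

Lemma expi2piD x y : expi2pi (x + y) = expi2pi x * expi2pi y.
Proof.
rewrite /expi2pi mulrDr cosD sinD; apply/eqP; rewrite eq_complex /=.
by apply/andP; split=> //; apply/eqP; ring.
Qed.

Lemma cmod_expi2pi x : cmod (expi2pi x) = 1.
Proof. by rewrite /cmod normc_def /= cos2Dsin2 sqrtr1. Qed.

Lemma expi2piX x n : expi2pi x ^+ n = expi2pi (n%:R * x).
Proof.
elim: n => [|n IH]; last by rewrite exprS IH -expi2piD -natr1; congr expi2pi; ring.
by rewrite expr0 mul0r /expi2pi mulr0 cos0 sin0.
Qed.

Lemma expi2pi_int (m : int) : expi2pi m%:~R = 1 :> CC R.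
Proof.
have h n : expi2pi (n%:R) = 1 :> CC R.
  rewrite -[n%:R]mulr1 -expi2piX (_ : expi2pi 1 = 1) ?expr1n //.
  by rewrite /expi2pi mulr1 [2 * pi]mulrC mulr_natr cos2pi sin2pi.
case: m => n; first exact: h.
rewrite NegzE mulrNz -pmulrn.
by have := expi2piD (- n.+1%:R) n.+1%:R; rewrite addNr (h 0%N) (h n.+1) mulr1 => <-.
Qed.

Lemma expi2pi_eq1 x : expi2pi x = 1 -> exists m : int, x = m%:~R.
Proof.
move=> h; exists (Num.floor x); apply/eqP; rewrite -subr_eq0.
set y := x - _.
have y0 : 0 <= y by rewrite subr_ge0 ge_floor.
have y1 : y < 1 by rewrite ltrBlDl -intrD1 floorD1_gt.
have hy : expi2pi y = 1.
  by rewrite /y expi2piD h mul1r -mulrNz expi2pi_int.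
rewrite eq_le y0 andbT leNgt; apply/negP => yp.
have : 0 < sin (pi * y).
  by apply: sin_gt0_pi; rewrite mulr_gt0 ?pi_gt0 //= -[ltRHS]mulr1 ltr_pM2l ?pi_gt0.
have : cos (2 * pi * y) = 1 by have := congr1 (@complex.Re R) hy.
have -> : 2 * pi * y = (pi * y) *+ 2 by rewrite -mulr_natl; ring.
rewrite cos_mulr2n cos2sin2; nra.
Qed.

Lemma irrational_expi2pi tau k : irrational tau -> (0 < k)%N -> expi2pi tau ^+ k != 1.
Proof.
move=> ht k0; apply/eqP; rewrite expi2piX => /expi2pi_eq1[m hm].
apply: ht; apply/rationalP; exists m, k.
by rewrite -hm mulrC mulKf // pnatr_eq0 -lt0n.
Qed.

Lemma expi2pi_cont t (e : R) : 0 < e ->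
  \forall x \near t, cmod (expi2pi x - expi2pi t) <= e.
Proof.
move=> e0; have e2 : 0 < e / 2 by lra.
have c (f : R -> R) : continuous f ->
    \forall x \near t, `|f (2 * pi * x) - f (2 * pi * t)| <= e / 2.
  move=> hf; have : f (2 * pi * x) @[x --> t] --> f (2 * pi * t).
    apply: (@continuous_comp _ _ _ (fun x => 2 * pi * x) f); last exact: hf.
    by apply: cvgM; [exact: cvg_cst | exact: cvg_id].
  by move=> /cvgrPdistC_le; exact.
near=> x.
have hc : `|cos (2 * pi * x) - cos (2 * pi * t)| <= e / 2.
  by near: x; apply: c; exact: continuous_cos.
have hs : `|sin (2 * pi * x) - sin (2 * pi * t)| <= e / 2.
  by near: x; apply: c; exact: continuous_sin.
by apply: le_trans (cmod_le_ReIm _) _; rewrite /=; lra.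
Unshelve. all: by end_near.
Qed.

(** Parametrizing the circle by the fractional parts of [n * tau] brings this down
    to the compactness of a segment. *)
Lemma rotation_compact tau (P : nat -> Prop) :
  (forall b : CC R, cmod b = 1 -> exists2 d : R, 0 < d & exists n0, forall n,
     (n0 <= n)%N -> cmod (expi2pi tau ^+ n - b) <= d -> P n) ->
  exists n0, forall n, (n0 <= n)%N -> P n.
Proof.
move=> hP; have /compact_near_coveringP hcov := @segment_compact R 0 1.
have := hcov nat (nbhs \oo) (fun n t => expi2pi tau ^+ n = expi2pi t -> P n) _.
case=> [t _|n0 _ h].
  have [d d0 [n0 h]] := hP (expi2pi t) (cmod_expi2pi t).
  exists ([set x | cmod (expi2pi x - expi2pi t) <= d], [set n | (n0 <= n)%N]).
    by split; [exact: expi2pi_cont | exists n0].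
  by move=> [x n] [/= hx hn] E; apply: h => //; rewrite E.
exists n0 => n /h; rewrite expi2piX => /(_ (n%:R * tau - (Num.floor (n%:R * tau))%:~R)).
apply.
- rewrite /= in_itv /= subr_ge0 ge_floor /=.
  by rewrite lerBlDl -intrD1 ltW // floorD1_gt.
- by rewrite expi2piD -mulrNz expi2pi_int mulr1.
Qed.

End UnitCircle.

(** * Counting roots in disjoint discs *)

Section Counting.
Implicit Types T : eqType.

Lemma sum_count_disjoint T U (cs : seq T) (rs : seq U) (P : T -> pred U) (Q : pred U) :
  uniq cs ->
  (forall x c c', c \in cs -> c' \in cs -> P c x -> P c' x -> c = c') ->
  (forall x c, c \in cs -> P c x -> Q x) ->
  (\sum_(c <- cs) count (P c) rs <= count Q rs)%N.
Proof.
move=> ucs disj PQ; elim: rs => [|x rs IH]; first by rewrite big1.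
rewrite /= big_split /=; apply: leq_add IH.
have -> : (\sum_(c <- cs) P c x)%N = count (fun c => P c x) cs.
  by rewrite -sum1_count [RHS]big_mkcond; apply: eq_bigr => c _; case: (P c x).
have [|] := boolP (has (fun c => P c x) cs); last first.
  by rewrite has_count -leqNgt leqn0 => /eqP ->.
move=> /hasP[c hc Pc]; rewrite (PQ x c hc Pc) -size_filter.
apply: (@uniq_leq_size _ _ [:: c]); first exact: filter_uniq.
by move=> c'; rewrite mem_filter inE => /andP[Pc' hc']; rewrite (disj x c' c).
Qed.

Lemma sum_subseq_uniq T (s cs : seq T) (f : T -> nat) :
  uniq s -> uniq cs -> {subset s <= cs} ->
  (\sum_(c <- cs) (if c \in s then f c else 0) = \sum_(c <- s) f c)%N.
Proof.
move=> us ucs sub; rewrite -big_mkcond -big_filter; apply: perm_big.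
apply: uniq_perm => //; first exact: filter_uniq.
by move=> c; rewrite mem_filter; case: (boolP (c \in s)) => //= /sub.
Qed.

Lemma seq_radius (R : realType) T (cs : seq T) (P : T -> R -> Prop) :
  (forall c d d', 0 < d' -> d' <= d -> P c d -> P c d') ->
  (forall c, c \in cs -> exists2 d : R, 0 < d & P c d) ->
  exists2 d : R, 0 < d & forall c, c \in cs -> P c d.
Proof.
move=> mono; elim: cs => [|c cs IH] h; first by exists 1.
have [|d d0 hd] := IH; first by move=> c' hc'; apply: h; rewrite inE hc' orbT.
have [d' d0' hd'] := h c (mem_head _ _).
have dd : 0 < Num.min d d' by rewrite lt_min d0.
exists (Num.min d d') => // c'; rewrite inE => /predU1P[->|/hd].
  by apply: mono hd' => //; rewrite ge_min lexx orbT.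
by apply: mono => //; rewrite ge_min lexx.
Qed.

End Counting.

(** * Zeros of the denominators accumulate with twice the multiplicity *)

Section Doubling.
Variables (R : realType) (q : CC R).
Hypothesis q_unit : cmod q = 1.
Hypothesis q_free : forall k, (0 < k)%N -> q ^+ k != 1.
Variable rho : R.
Hypothesis rho_ge0 : 0 <= rho.
Hypothesis rho_lt1 : rho < 1.
Hypothesis G_ucvg : pseries_uniform (G_coef q) rho.
Implicit Types (b c z : CC R).

(** As [rho < 1], the second product in the formula for [nu] is negligible. *)
Lemma nu_near b (e : R) : cmod b = 1 -> 0 < e ->
  exists2 d : R, 0 < d & exists n0, forall n, (n0 <= n)%N ->
    cmod (q ^+ n - b) <= d -> forall z, cmod z <= rho ->
    cmod ((nu_shift q n).[z] - G q (q * z) * Gconj q (b * z)) <= e.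
Proof.
move=> b1 e0; have lG := G_poly_limit G_ucvg; have lC := Gconj_poly_limit G_ucvg.
have [M M0 hM] := poly_limit_bounded rho_ge0 lG.
have hMc z : cmod z <= rho -> cmod (Gconj q z) <= M.
  by move=> hz; rewrite /Gconj cmod_conj hM // cmod_conj.
have e2 : 0 < e / 2 by lra.
have [d d0 hd] := poly_limit_ucont rho_ge0 lC (divr_gt0 e2 M0).
have [n0 hn0] := exp_small rho_ge0 rho_lt1 (divr_gt0 e2 (mulr_gt0 M0 M0)).
exists d => //; exists n0 => n /hn0 hn hnb z hz.
rewrite (nu_shift_formula q_unit q_free rho_ge0 G_ucvg) //.
set P := \prod_(i < n) _.
have P1 : cmod P = 1 by rewrite cmod_prod big1 // => i _; rewrite cmod_qX.
have z1 : cmod (q ^+ n * z) <= rho by rewrite cmod_qXM.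
have z2 : cmod (b * z) <= rho by rewrite cmodM b1 mul1r.
have z3 : cmod (q ^+ n * z - b * z) <= d.
  rewrite -mulrBl cmodM -[leRHS]mulr1; apply: ler_pM; rewrite ?cmod_ge0 //.
  exact: le_trans hz (ltW rho_lt1).
have m1 : cmod (G q (q * (q ^+ n * z))) <= M by apply: hM; rewrite cmod_qM.
have m2 : cmod (Gconj q z) <= M by exact: hMc.
have m3 : cmod (G q (q * z)) <= M by apply: hM; rewrite cmod_qM.
have m4 := hd _ _ z1 z2 z3; move: m1 m2 m3 m4.
generalize (G q (q * z)) (Gconj q (q ^+ n * z)) (Gconj q (b * z)) (Gconj q z)
  (G q (q * (q ^+ n * z))) => g1 g2 g3 g4 g5 m1 m2 m3 m4.
have -> : g1 * g2 - (- z) ^+ n * P * g4 * g5 - g1 * g3 =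
  g1 * (g2 - g3) - (- z) ^+ n * P * (g4 * g5) by ring.
apply: le_trans (cmodD _ _) _; rewrite cmodN !cmodM P1 mulr1 cmodX cmodN.
rewrite [leRHS](splitr e); apply: lerD.
  rewrite mulrC -[leRHS](divfK (lt0r_neq0 M0)).
  by apply: ler_pM; rewrite ?cmod_ge0.
have MM := mulr_gt0 M0 M0.
rewrite -[leRHS](divfK (lt0r_neq0 MM)); apply: ler_pM.
- by rewrite exprn_ge0 // cmod_ge0.
- by rewrite mulr_ge0 ?cmod_ge0.
- by apply: le_trans hn; rewrite lerXn2r ?nnegrE ?cmod_ge0.
- by apply: ler_pM; rewrite ?cmod_ge0.
Qed.

Lemma G_finite_order c : cmod c < rho -> exists k, order_at (G q) c k.
Proof.
move=> hc; apply: (finite_order q_unit q_free (G_poly_limit G_ucvg) hc).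
by rewrite (G0 q) oner_neq0.
Qed.

(** The limit function [G (q z) * Gconj (b z)] vanishes at the given zeros [s] of
    [G (q z)] and at their images under [a |-> (q a)^* / b], on the same circle;
    where a zero of one factor meets a zero of the other the orders add up.  A
    single factor may also vanish at a point not given as its zero, which
    can only increase the order; that this order is finite is [finite_order]. *)
Lemma doubled_zeros b r (s : seq (CC R)) (m : CC R -> nat) (U : set (CC R)) :
  cmod b = 1 -> r < rho -> uniq s ->
  (forall a, a \in s -> cmod a = r /\ order_at (fun z => G q (q * z)) a (m a)) ->
  open U -> circle r `<=` U ->
  exists2 d : R, 0 < d & exists n0, forall n, (n0 <= n)%N ->
    cmod (q ^+ n - b) <= d -> forall lc rs,
    nu_shift q n = lc *: \prod_(x <- rs) ('X - x%:P) ->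
    (2 * \sum_(a <- s) m a <= count (fun x => x \in U) rs)%N.
Proof.
move=> b1 rr us hs oU cU.
have q0 := q_neq0 q_unit.
have b0 : b != 0 by rewrite -cmod_eq0 b1 oner_neq0.
pose phi a : CC R := ((q * a)^*)%C / b.
pose psi c : CC R := q^-1 * ((b * c)^*)%C.
have phiK a : psi (phi a) = a.
  by rewrite /psi /phi mulrCA divff // mulr1 conjcK mulKf.
have psiE c : q * psi c = ((b * c)^*)%C by rewrite /psi mulVKf.
pose s' := map phi s.
have us' : uniq s' by rewrite map_inj_uniq //; exact: can_inj phiK.
pose cs := undup (s ++ s').
have csr c : c \in cs -> cmod c = r.
  rewrite mem_undup mem_cat => /orP[/hs[]//|/mapP[a /hs[ha _] ->]].
  by rewrite /phi cmodM cmodV b1 invr1 mulr1 cmod_conj cmod_qM.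
pose F z := G q (q * z) * Gconj q (b * z).
have /choice[mm hmm] c : exists M, c \in cs -> order_at F c M /\
    ((if c \in s then m c else 0) + (if c \in s' then m (psi c) else 0) <= M)%N.
  have [cc|] := boolP (c \in cs); last by exists 0%N.
  have cr : cmod c < rho by rewrite (csr c cc).
  have [k1 [hk1 l1]] : exists k, order_at (fun z => G q (q * z)) c k /\
      ((if c \in s then m c else 0) <= k)%N.
    case: ifP => [/hs[_ h]|_]; first by exists (m c).
    have [|k hk] := @G_finite_order (q * c); first by rewrite cmod_qM.
    by exists k; split=> //; exact: order_at_rotate.
  have [k2 [hk2 l2]] : exists k, order_at (fun z => Gconj q (b * z)) c k /\
      ((if c \in s' then m (psi c) else 0) <= k)%N.
    have lift k : order_at (G q) ((b * c)^*)%C k ->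
        order_at (fun z => Gconj q (b * z)) c k.
      by move=> h; apply: (order_at_rotate (f := Gconj q) b1); exact: order_at_conj.
    case: ifP => [/mapP[a ha ac]|_].
      exists (m (psi c)); split=> //; apply: lift; rewrite -psiE ac phiK.
      by apply: (order_at_unrotate q_unit); have [] := hs a ha.
    have [|k hk] := @G_finite_order ((b * c)^*)%C.
      by rewrite cmod_conj cmodM b1 mul1r.
    by exists k; split=> //; exact: lift.
  by exists (k1 + k2)%N => _; split; [exact: order_atM | exact: leq_add].
have [|c cc|e1 e10 he1] := @seq_radius R _ cs
  (fun c d => forall z, cmod (z - c) < d -> U z /\ cmod z <= rho).
- by move=> c d d' _ dd h z zd; apply: h; exact: lt_le_trans zd dd.
- have Uc : U c by apply: cU; rewrite /circle /= cmodE csr.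
  have [d d0 hd] := (near_cmodP c U).1 (open_nbhs_nbhs (conj oU Uc)).
  exists (Num.min d (rho - r)); first by rewrite lt_min d0 subr_gt0.
  move=> z; rewrite lt_min => /andP[/hd Uz zr]; split=> //.
  by have := cmodD (z - c) c; rewrite subrK (csr c cc); lra.
have [|c cc|e2 e20 he2] := @seq_radius R _ cs
  (fun c d => forall c', c' \in cs -> c != c' -> 2 * d <= cmod (c - c')).
- by move=> c d d' _ dd h c' cc' ne; apply: le_trans (h c' cc' ne); lra.
- apply: (@seq_radius R _ cs (fun c' d => c != c' -> 2 * d <= cmod (c - c'))).
    by move=> c' d d' _ dd h ne; apply: le_trans (h ne); lra.
  move=> c' _; have [->|ne] := eqVneq c c'; first by exists 1.
  exists (cmod (c - c') / 2); last by move=> _; lra.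
  by rewrite divr_gt0 // cmod_gt0 subr_eq0.
pose eps := Num.min e1 e2.
have eps0 : 0 < eps by rewrite lt_min e10.
have [|c cc|dl dl0 hdl] := @seq_radius R _ cs (fun c d => forall lc rs,
    (forall z, cmod (z - c) < eps ->
       cmod (lc * \prod_(x <- rs) (z - x) - F z) <= d) ->
    (mm c <= count (fun x => (cmod (x - c) < eps)%R) rs)%N).
- move=> c d d' _ dd h lc rs hrs; apply: (h lc) => z zc.
  exact: le_trans (hrs z zc) dd.
- have [hc _] := hmm c cc; exact: (hurwitz_local q_unit q_free hc eps0).
have [d d0 [n0 hn0]] := nu_near b1 dl0.
exists d => //; exists n0 => n hn hnb lc rs hnu.
have nuE z : (nu_shift q n).[z] = lc * \prod_(x <- rs) (z - x).
  rewrite hnu hornerZ horner_prod; congr (_ * _).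
  by apply: eq_bigr => x _; rewrite hornerXsubC.
apply: (@leq_trans (\sum_(c <- cs) mm c)).
  apply: (@leq_trans (\sum_(c <- cs) ((if c \in s then m c else 0) +
      (if c \in s' then m (psi c) else 0)))).
    rewrite big_split /= !sum_subseq_uniq ?undup_uniq //.
    + rewrite [X in (_ + X)%N]big_map.
      by under [X in (_ + X)%N]eq_bigr do rewrite phiK; rewrite addnn mul2n.
    + by move=> c cs'; rewrite mem_undup mem_cat cs' orbT.
    + by move=> c cs'; rewrite mem_undup mem_cat cs'.
  rewrite big_seq [leqRHS]big_seq; apply: leq_sum => c /hmm[].
  by [].
apply: (@leq_trans (\sum_(c <- cs) count (fun x => (cmod (x - c) < eps)%R) rs)).
  rewrite big_seq [leqRHS]big_seq; apply: leq_sum => c cc.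
  apply: (hdl c cc lc) => z; rewrite lt_min => /andP[z1 _].
  rewrite -nuE; apply: hn0 => //; exact: (he1 c cc z z1).2.
apply: sum_count_disjoint; first exact: undup_uniq.
- move=> x c c' cc cc'; rewrite !lt_min => /andP[_ x1] /andP[_ x2].
  apply/eqP; apply: contraT => ne; have := he2 c cc c' cc' ne.
  by have := cmodB_le c x c'; rewrite [cmod (c - x)]cmodBC; lra.
- move=> x c cc; rewrite lt_min => /andP[x1 _].
  by apply: mem_set; exact: (he1 c cc x x1).1.
Qed.

End Doubling.

Theorem corollary2p5 (R : realType) (tau : R) (r : R) (l : nat)
    (U : set (CC R)) :
  irrational tau ->
  let q := expi2pi tau in
  (r%:E < G_radius q)%E ->
  total_pole_multiplicity (H q) (circle r) l ->
  open U -> circle r `<=` U ->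
  exists n0 : nat, forall n : nat, (n0 <= n)%N ->
    exists2 N : nat,
      total_pole_multiplicity (convergent q n) U N & (2 * l <= N)%N.
Proof.
move=> irr q hr [s [m [us hs _ ->]]] oU cU.
have q_unit : cmod q = 1 := cmod_expi2pi tau.
have q_free k : (0 < k)%N -> q ^+ k != 1 := irrational_expi2pi irr.
suff [n0 h] : exists n0, forall n, (n0 <= n)%N -> forall lc rs,
    nu_shift q n = lc *: \prod_(x <- rs) ('X - x%:P) ->
    (2 * \sum_(a <- s) m a <= count (fun x => x \in U) rs)%N.
  exists n0 => n hn; have [rs hrs] := closed_field_poly_normal (nu q n).
  exists (count (fun x => x \in U) rs); first exact: convergent_poles hrs.
  by apply: (h n.+1) hrs; exact: leqW.
case: s us hs => [|a0 s'] us hs; first by exists 0%N => n _ lc rs _; rewrite big_nil muln0.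
have circ a : circle r a -> cmod a = r by rewrite /circle /= cmodE => -[].
have r0 : 0 <= r by rewrite -(circ a0) ?cmod_ge0 //; have [] := hs a0 (mem_head _ _).
have [_ [z1 cz1 <-]] := ereal_sup_gt hr; rewrite lte_fin -/(cmod z1) => rz1.
have ucvg rho : 0 <= rho -> rho < cmod z1 -> pseries_uniform (G_coef q) rho.
  exact: pseries_ucvg.
(* The radius [rho1] serves to show [r < 1]; then [rho] lies between [r] and [1]. *)
pose rho1 := (r + cmod z1) / 2.
have rho10 : 0 <= rho1 by rewrite /rho1; lra.
have rho1z : rho1 < cmod z1 by rewrite /rho1; lra.
have rho11 := radius_le1 q_unit q_free rho10 (ucvg _ rho10 rho1z).
have r_rho1 : r < rho1 by rewrite /rho1; lra.
pose rho := (r + rho1) / 2.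
have rho0 : 0 <= rho by rewrite /rho; lra.
have rho_lt1 : rho < 1 by rewrite /rho; lra.
have r_rho : r < rho by rewrite /rho; lra.
have hG : pseries_uniform (G_coef q) rho.
  by apply: ucvg => //; rewrite /rho; lra.
apply: (@rotation_compact R tau) => b b1.
apply: (doubled_zeros q_unit q_free rho0 rho_lt1 hG b1 r_rho us) => // a /hs[ca pa].
split; first exact: circ.
by apply: (H_pole_order q_unit q_free rho0 hG) pa; rewrite circ.
Qed.
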